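(* Let $f$ be a valid function on $A\times\mathbb{R}$ ($A$ possibly unbounded) that is strictly log-concave with respect to $y$, and consider the pairwise comparison sampling model described in the context (latent scores $u\in\mathbb{R}^n$ with $u_1=0$ and dynamic range $M_n$, comparison counts $n_{ij}\sim\mathrm{Bin}(T,p_{ij,n})$, minimum and maximum comparison rates $p_n,q_n$). Let $C_n^{(1)}=\int_{[0,\infty)}f(x;M_n)\,dx$, $g(x;y)=\frac{\partial}{\partial y}\log f(x;y)$, $g_2(x;y)=\frac{\partial}{\partial y}g(x;y)$, $$C_n^{(2)}=\sup_{x\in A,\,|y|\le M_n}|g(x;y)|,\qquad C_n^{(3)}=\inf_{x\in A,\,|y|\le M_n+1}|g_2(x;y)| .$$ Suppose that the following uniform sub-gaussian condition holds: with $X_y$ denoting a random variable with density (mass function) $f(\cdot\,;y)$, there are constants $C_n^{(4)}$ such that $$\sup_{|y|\le M_n}\bigl\|g(X_y;y)-\mathbb{E}[g(X_y;y)]\bigr\|_{\psi_2}\le C_n^{(4)} ,$$ and let $$\omega_n=\min\left\{\frac{C_n^{(4)}}{C_n^{(3)}},\frac{C_n^{(2)}}{C_n^{(3)}}\right\}.$$ Suppose also that $$\Delta_n:=\omega_n\sqrt{\frac{q_n^2(\log n)^3}{n p_n^3}}\to0\quad\text{and}\quad \frac{\log n}{n p_n\,|\log C_n^{(1)}|}\to0\qquad\text{as } n\to\infty .$$ Then there exists an absolute constant $C>0$ such that for all sufficiently large $n$, with probability at least $1-n^{-2}$, the maximum likelihood estimator $\widehat{u}=\arg\max_{v\in\mathbb{R}^n,\,v_1=0}l(v)$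 uniquely exists and satisfies $$\|\widehat{u}-u\|_\infty\le C\Delta_n .$$
   Context: **Link function.** $A\subset\mathbb{R}$ is symmetric ($A=-A$) and is either continuous (integrals over $A$ are with respect to Lebesgue measure) or discrete (integrals $\int\cdot\,dx$ are read as sums over $A$). A function $f:A\times\mathbb{R}\to(0,\infty)$ is *valid* if: (1) $\int_A f(x;y)\,dx=1$ for every $y\in\mathbb{R}$; (2) $f(x;y)=f(-x;-y)$ for all $(x,y)\in A\times\mathbb{R}$; (3) for every $x\in A$ with $x<0$, $f(x;y)$ is decreasing in $y$ and $f(x;y)\to0$ as $y\to\infty$; (4) $\sup_{y\in\mathbb{R}}f(x;y)<\infty$ for every $x\in A$. $f$ is *strictly log-concave with respect to $y$* if for every $x\in A$, $\log f(x;y)$ is twice differentiable in $y$ and $\frac{\partial^2}{\partial y^2}\log f(x;y)<0$ for all $y\in\mathbb{R}$. $A$ and $f$ do not depend on $n$. **Sub-gaussian norm.** $\|Z\|_{\psi_2}=\inf\{t\ge0:\mathbb{E}[\exp(Z^2/t^2)]\le2\}$. **Sampling model.** For each $n$ there is a latent score vector $u=(u_1,\dots,u_n)\in\mathbb{R}^n$ (depending on $n$) with $u_1=0$, and $M_n=\max_{i,j}|u_i-u_j|$. $T\ge1$ is a fixed integer. For each pair $i\ne j$ there is a comparison rate $p_{ij,n}=p_{ji,n}\in(0,1]$, with $p_n=\min_{i\neq j}p_{ij,n}$ and $q_n=\max_{i\neq j}p_{ij,n}$. The numbers of comparisons $n_{ij}=n_{ji}$ are independent over pairs $i<j$, with $n_{ij}\sim\mathrm{Bin}(T,p_{ij,n})$.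 Given $\{n_{ij}\}$, the outcomes $X_{ij}^{(t)}$ ($i<j$, $1\le t\le n_{ij}$) are independent with density (mass function) $f(\cdot\,;u_i-u_j)$, and $X_{ji}^{(t)}=-X_{ij}^{(t)}$. **Log-likelihood.** $l(v)=\frac12\sum_{i\ne j}\sum_{t=1}^{n_{ij}}\log f(X_{ij}^{(t)};v_i-v_j)$ for $v\in\mathbb{R}^n$. Convention: a ratio defining $\omega_n$ is $\infty$ if its numerator is $\infty$ or $C_n^{(3)}=0$; the hypothesis on $\Delta_n$ forces $\omega_n<\infty$ for large $n$. *)

(* Defs.v *)
From HB Require Import structures.
From mathcomp Require Export all_boot all_order all_algebra.
From mathcomp Require Export all_classical all_reals all_analysis.
Export Order.TTheory GRing.Theory Num.Theory.
Export numFieldNormedType.Exports.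

Set Implicit Arguments.
Unset Strict Implicit.
Unset Printing Implicit Defensive.

Local Open Scope classical_set_scope.
Local Open Scope ring_scope.

Variant domain_kind := Continuous | Discrete.

Section LinkFunction.
Context {R : realType}.
Implicit Types (k : domain_kind) (A : set R) (f : R -> R -> R).

(* "\int_A . dx" is the integral against this measure; against the counting
   measure it is the sum over A. *)
Definition base_measure k : {measure set (measurableTypeR R) -> \bar R} :=
  match k with
  | Continuous => lebesgue_measure
  | Discrete => counting
  end.

Definition link_domain k A : Prop :=
  (forall x, A x -> A (- x)) /\
  match k with
  | Continuous => measurable (A : set (measurableTypeR R))
  | Discrete => countable A
  end.

(* Only the values f x y with A x matter. The measurability clause is implicit
   in the existence of the integral and automatic when A is countable.
   "Decreasing" is read in the weak sense. *)
Record valid_link k A f : Prop := ValidLink {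
  link_gt0 : forall x y, A x -> 0 < f x y;
  link_measurable : forall y,
    measurable_fun (A : set (measurableTypeR R)) (f ^~ y);
  link_integral1 : forall y,
    (\int[base_measure k]_(x in A) (f x y)%:E = 1)%E;
  link_sym : forall x y, A x -> f x y = f (- x) (- y);
  link_decreasing : forall x, A x -> x < 0 ->
    {homo f x : y z / y <= z >-> z <= y};
  link_cvg0 : forall x, A x -> x < 0 -> f x y @[y --> +oo] --> 0;
  link_bounded : forall x, A x -> (ereal_sup [set (f x y)%:E | y in setT] < +oo)%E
}.

Definition glink f (x y : R) : R := derive1 (fun z => ln (f x z)) y.

Definition glink2 f (x y : R) : R := derive1 (glink f x) y.

Definition strictly_log_concave A f : Prop :=
  forall x y, A x ->
    [/\ derivable (fun z => ln (f x z)) y 1,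
        derivable (glink f x) y 1 &
        glink2 f x y < 0].

(* P(X_y \in B) for X_y with density (mass function) f(.; y) on A. *)
Definition link_law k A f (y : R) (B : set R) : \bar R :=
  (\int[base_measure k]_(x in A `&` B) (f x y)%:E)%E.

(* E[h(X_y)]. *)
Definition link_expectation k A f (y : R) (h : R -> \bar R) : \bar R :=
  (\int[base_measure k]_(x in A) (h x * (f x y)%:E))%E.

(* Sub-gaussian norm of Z, for the expectation operator E. The value t = 0 is
   left out of the infimum since division by 0 is total (Z ^ 2 / 0 = 0); this
   does not change the infimum. *)
Definition psi2_norm (S : Type) (E : (S -> \bar R) -> \bar R) (Z : S -> R)
    : \bar R :=
  ereal_inf [set t%:E | t in
    [set t : R | 0 < t /\
      (E (fun s => (expR (Z s ^+ 2 / t ^+ 2))%:E) <= 2%:E)%E]].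

Definition centered_score k A f (y : R) : R -> R :=
  fun x => glink f x y
    - fine (link_expectation k A f y (fun z => (glink f z y)%:E)).

Definition score_psi2_sup k A f (M : R) : \bar R :=
  ereal_sup [set psi2_norm (link_expectation k A f y) (centered_score k A f y)
            | y in [set y : R | `|y| <= M]].

Definition C1 k A f (M : R) : R :=
  fine (\int[base_measure k]_(x in A `&` `[0%R, +oo[) (f x M)%:E)%E.

Definition C2 A f (M : R) : \bar R :=
  ereal_sup [set (`|glink f xy.1 xy.2|)%:E
            | xy in [set xy : R * R | A xy.1 /\ `|xy.2| <= M]].

Definition C3 A f (M : R) : \bar R :=
  ereal_inf [set (`|glink2 f xy.1 xy.2|)%:E
            | xy in [set xy : R * R | A xy.1 /\ `|xy.2| <= M + 1]].

(* The library's 0 * +oo = 0 is overridden when b = 0. *)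
Definition ratio (a b : \bar R) : \bar R :=
  if (a == +oo%E) || (b == 0%E) then +oo%E else (a / b)%E.

Definition omega A f (M C4 : R) : \bar R :=
  Order.min (ratio C4%:E (C3 A f M)) (ratio (C2 A f M) (C3 A f M)).

End LinkFunction.

Section Model.
Context {R : realType}.

(* The default values 0, 1, 0 of the iterated max/min are never selected
   wrongly: differences are nonnegative and rates lie in ]0, 1]. *)
Definition dynamic_range n (u : 'rV[R]_n) : R :=
  \big[Num.max/0]_(ij : 'I_n * 'I_n) `|u 0 ij.1 - u 0 ij.2|.

Definition min_rate n (p : 'I_n -> 'I_n -> R) : R :=
  \big[Num.min/1]_(ij : 'I_n * 'I_n | ij.1 != ij.2) p ij.1 ij.2.

Definition max_rate n (p : 'I_n -> 'I_n -> R) : R :=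
  \big[Num.max/0]_(ij : 'I_n * 'I_n | ij.1 != ij.2) p ij.1 ij.2.

(* "v_1 = 0": indices start at 0 here. *)
Definition anchored n (v : 'rV[R]_n) : Prop :=
  forall i : 'I_n, i = 0%N :> nat -> v 0 i = 0.

Definition comparison_rates n (p : 'I_n -> 'I_n -> R) : Prop :=
  forall i j, i != j -> p i j = p j i /\ 0 < p i j <= 1.

Definition Delta (A : set R) (f : R -> R -> R) n (u : 'rV[R]_n)
    (p : 'I_n -> 'I_n -> R) (C4 : R) : \bar R :=
  (omega A f (dynamic_range u) C4 *
   (Num.sqrt (max_rate p ^+ 2 * ln n%:R ^+ 3
              / (n%:R * min_rate p ^+ 3)))%:E)%E.

Context (k : domain_kind) (A : set R) (f : R -> R -> R) (T : nat) (n : nat).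
Context (d : measure_display) (Omega : measurableType d)
  (P : probability Omega R).
Implicit Types (u v : 'rV[R]_n) (p : 'I_n -> 'I_n -> R).
Implicit Types (N : 'I_n -> 'I_n -> {RV P >-> nat}).
Implicit Types (X : 'I_n -> 'I_n -> nat -> {RV P >-> R}).

(* X i j t is the (t+1)-st outcome between i and j; only t < N i j w is
   meaningful, and nothing is assumed about the other values. The last clause
   is the conditional joint law given the counts: conditionally on the event
   {N i j = m i j for all i < j}, the X i j t (i < j, t < m i j) are independent
   with densities f(.; u_i - u_j). *)
Record sampling_model u p N X : Prop := SamplingModel {
  count_sym : forall i j w, i != j -> N i j w = N j i w;
  count_binomial : forall (i j : 'I_n) (B : set nat), (i < j)%N ->
    P (N i j @^-1` B) = binomial_prob T (p i j) B;
  count_independent : forall B : 'I_n -> 'I_n -> set nat,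
    P [set w | forall i j : 'I_n, (i < j)%N -> B i j (N i j w)] =
    (\prod_(i < n) \prod_(j < n | (i < j)%N) fine (P (N i j @^-1` B i j)))%:E;
  outcome_antisym : forall i j t w, i != j -> (t < N i j w)%N ->
    X j i t w = - X i j t w;
  outcome_conditional_law :
    forall (m : 'I_n -> 'I_n -> nat)
           (B : 'I_n -> 'I_n -> nat -> set (measurableTypeR R)),
    (forall i j t, measurable (B i j t)) ->
    P [set w | (forall i j : 'I_n, (i < j)%N -> N i j w = m i j) /\
               (forall (i j : 'I_n) t, (i < j)%N -> (t < m i j)%N ->
                  B i j t (X i j t w))] =
    (P [set w | forall i j : 'I_n, (i < j)%N -> N i j w = m i j] *
     (\prod_(i < n) \prod_(j < n | (i < j)%N) \prod_(t < m i j)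
        fine (link_law k A f (u 0 i - u 0 j)%R (B i j t)))%:E)%E
}.

Definition log_likelihood N X (w : Omega) v : R :=
  2^-1 * \sum_(i < n) \sum_(j < n | i != j) \sum_(t < N i j w)
    ln (f (X i j t w) (v 0 i - v 0 j)).

Definition is_mle N X (w : Omega) v : Prop :=
  anchored v /\
  forall v', anchored v' -> log_likelihood N X w v' <= log_likelihood N X w v.

(* Inner probability, so that no measurability of E is presupposed; it is
   r <= P E when E is measurable. *)
Definition with_probability_at_least (r : R) (E : set Omega) : Prop :=
  exists F : set Omega, [/\ measurable F, F `<=` E & (r%:E <= P F)%E].

End Model.

(* Main.v *)
(** The maximum likelihood estimator is first taken over the compact set of
    anchored [v] with [max_(i,j) ((v - u) i - (v - u) j) <= 1].  Put
    [delta = v - u] for this restricted maximizer.  Lowering [v] on an upper set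
    [S] of [delta] stays in the compact set, so the score summed over the
    boundary of [S] is nonnegative; comparing with the score at [u], the total
    drop of [delta] over the comparisons leaving [S] is at most [1 / C3] times
    the noise across the boundary of [S], which with high probability is
    [O (K sqrt (#boundary * #|S| * log n))] for all [S] at once.  By Markov's
    inequality, half of the comparisons leaving [S] have a drop at most
    [eta = O (K / C3 * sqrt (log n / (n p)))], and since degrees are [O (n q)],
    lowering the level by [eta] multiplies [#|S|] by [1 + c p / q].  After
    [O ((q / p) log n)] steps from the top and from the bottom the two level sets
    meet, so the oscillation of [delta] is [O (Delta)].  For large [n] this is
    less than [1]: the constraint is inactive, and concavity makes the
    restricted maximizer the unique global one.

    The score has mean zero and is sub-gaussian: concavity gives
    [f x (y + l) <= exp (l * g x y) * f x y], hence [E exp (l * g) >= 1] for all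
    [l], which forces [E g = 0].  The same inequality, being strict, bounds the
    sub-gaussian constant away from [0] at [y = 0]; therefore [omega_n] is
    bounded below and [Delta_n -> 0] alone yields [n p / log n -> oo]. *)
Require Import Defs.
From mathcomp Require Import measurable_realfun.
From mathcomp Require Import ring lra zify.

Set Implicit Arguments.
Unset Strict Implicit.
Unset Printing Implicit Defensive.

Local Open Scope classical_set_scope.
Local Open Scope ring_scope.

(** * Expansion of level sets *)

Lemma le_of_eq (R : numDomainType) (x y : R) : x = y -> x <= y.
Proof. by move=> ->. Qed.

Section Cut.
Context {R : realType} (n : nat).
Implicit Types (w : 'I_n -> 'I_n -> R) (S : {set 'I_n}) (d : 'I_n -> R).

(** No sign or symmetry is required of [w]: the same sum serves for comparison counts, for counts
    weighted by drops, for antisymmetric scores, and for the constant 1. *)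
Definition cut w S : R := \sum_(i in S) \sum_(j in ~: S) w i j.

Lemma cut_indicE w S :
  cut w S = \sum_i \sum_j ((i \in S) && (j \notin S))%:R * w i j.
Proof.
rewrite /cut big_mkcond; apply: eq_bigr => i _.
case: ifP => iS; last by rewrite big1// => j _; rewrite mul0r.
rewrite big_mkcond; apply: eq_bigr => j _; rewrite finset.in_setC.
by case: (j \in S); rewrite /= ?mul0r ?mul1r.
Qed.

Definition upset d (a : R) : {set 'I_n} := [set i | a <= d i]%SET.

Lemma in_upset d a i : (i \in upset d a) = (a <= d i).
Proof. by rewrite inE. Qed.

Lemma upsetS d a b : b <= a -> (upset d a \subset upset d b)%SET.
Proof. by move=> ba; apply/fintype.subsetP => i; rewrite !in_upset; exact: le_trans. Qed.

(** With [m := cut w S], the mean drop across the boundary is at most [kappa * sqrt (#|S| / m) <=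
    kappa / sqrt b]. By Markov's inequality at least half of [m] drops by at most twice that, hence
    lands in the enlarged set minus [S], where each vertex absorbs at most [D]. *)
Lemma upset_step w d (a kappa b D : R) :
  (forall i j, 0 <= w i j) -> 0 < kappa -> 0 < b ->
  (forall j, \sum_i w i j <= D) ->
  let S := upset d a in
  b * #|S|%:R <= cut w S ->
  cut (fun i j => w i j * (d i - d j)) S <= kappa * Num.sqrt (cut w S * #|S|%:R) ->
  b / 2 * #|S|%:R <= D * (#|upset d (a - 2 * kappa / Num.sqrt b)|%:R - #|S|%:R).
Proof.
move=> w0 k0 b0 degD S bS drop.
set eta := 2 * kappa / Num.sqrt b; set S' := upset d (a - eta).
have sb0 : 0 < Num.sqrt b by rewrite sqrtr_gt0.
have eta0 : 0 < eta by rewrite divr_gt0// mulr_gt0.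
have SS' : (S \subset S')%SET by apply: upsetS; lra.
set m := cut w S in bS drop *.
(* The boundary weight splits into pairs that leave even the enlarged set, whose drop exceeds [eta],
   and pairs that end in its new layer. *)
pose far := \sum_(i in S) \sum_(j in ~: S') w i j.
pose near := \sum_(i in S) \sum_(j in S' :\: S) w i j.
have mE : m = near + far.
  rewrite /m /cut /near /far -big_split; apply: eq_bigr => i iS.
  rewrite (bigID (mem S'))/=; congr (_ + _); apply: eq_bigl => j.
    by rewrite finset.in_setD finset.in_setC.
  have := fintype.subsetP SS' j; rewrite !finset.in_setC.
  by case: (j \in S) => //= ->.
have near_le : near <= D * (#|S'|%:R - #|S|%:R).
  rewrite /near exchange_big/=.
  apply: (@le_trans _ _ (\sum_(j in S' :\: S) D)).
    apply: ler_sum => j _; apply: le_trans (degD j).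
    by rewrite [leRHS](bigID (mem S))/= lerDl sumr_ge0.
  rewrite sumr_const -[_ *+ _]mulr_natr; rewrite cardsD (finset.setIidPr SS') natrB//.
  exact: fintype.subset_leq_card.
have far_le : eta * far <= kappa * Num.sqrt (m * #|S|%:R).
  apply: le_trans drop; rewrite /cut /far mulr_sumr; apply: ler_sum => i iS.
  rewrite mulr_sumr.
  rewrite [leRHS](bigID (mem (~: S')))/=.
  rewrite [X in _ <= X + _](eq_bigl [in ~: S'])/= => [|j]; last first.
    have := fintype.subsetP SS' j; rewrite !finset.in_setC.
    by case: (j \in S) => //= ->.
  rewrite -[leLHS]addr0; apply: lerD.
    apply: ler_sum => j; rewrite !inE -ltNge => jS'.
    rewrite mulrC ler_wpM2l//; move: iS; rewrite in_upset; lra.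
  apply: sumr_ge0 => j /andP[jS _]; apply: mulr_ge0 => //.
  by move: iS jS; rewrite !inE -ltNge; lra.
have m0 : 0 <= m by apply: le_trans bS; rewrite mulr_ge0// ltW.
have sq : Num.sqrt (m * #|S|%:R) <= m / Num.sqrt b.
  rewrite ler_pdivlMr// -sqrtrM ?mulr_ge0// -[leRHS]ger0_norm// -sqrtr_sqr.
  apply: ler_wsqrtr; rewrite expr2 -mulrA ler_wpM2l//; lra.
have far2 : far <= m / 2.
  have : eta * far <= eta * (m / 2).
    apply: le_trans far_le _; apply: le_trans (ler_wpM2l (ltW k0) sq) _.
    by apply: le_of_eq; rewrite /eta; field; lra.
  by rewrite ler_pM2l.
by apply: le_trans near_le; lra.
Qed.

(** Iteration of [upset_step]: as long as the level set is a minority, each descent by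
    [2 * kappa / sqrt b] multiplies its size by at least [1 + b / (2 * D)]. *)
Lemma upset_majority w d (a kappa b D : R) (k : nat) :
  (forall i j, 0 <= w i j) -> 0 < kappa -> 0 < b -> 0 < D ->
  (forall j, \sum_i w i j <= D) ->
  (forall S, (0 < #|S|)%N -> (2 * #|S| <= n)%N -> b * #|S|%:R <= cut w S) ->
  (forall c, let S := upset d c in (0 < #|S|)%N -> (2 * #|S| <= n)%N ->
    cut (fun i j => w i j * (d i - d j)) S <= kappa * Num.sqrt (cut w S * #|S|%:R)) ->
  (0 < #|upset d a|)%N -> n%:R <= (1 + b / (2 * D)) ^+ k ->
  (n < 2 * #|upset d (a - k%:R * (2 * kappa / Num.sqrt b))|)%N.
Proof.
move=> w0 k0 b0 D0 degD hcut hdrop Sa nk.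
set eta := 2 * kappa / Num.sqrt b; set rho := b / (2 * D) in nk *.
have sb0 : 0 < Num.sqrt b by rewrite sqrtr_gt0.
have eta0 : 0 < eta by rewrite divr_gt0// mulr_gt0.
have rho0 : 0 < rho by rewrite divr_gt0// mulr_gt0.
pose U k := upset d (a - k%:R * eta).
have US j l : (j <= l)%N -> (#|U j| <= #|U l|)%N.
  move=> jl; apply/fintype.subset_leq_card/upsetS.
  by rewrite lerD2l lerN2 ler_wpM2r ?ler_nat// ltW.
have U0 : U 0%N = upset d a by rewrite /U mul0r subr0.
have Upos j : (0 < #|U j|)%N by apply: leq_trans (US 0%N j _) => //; rewrite U0.
have main j : (n < 2 * #|U j|)%N \/ (1 + rho) ^+ j <= #|U j|%:R.
  elim: j => [|j [IH|IH]].
  - by right; rewrite expr0 ler1n.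
  - by left; apply: leq_trans IH _; rewrite leq_mul2l/=; exact: US.
  have [big|small] := ltnP n (2 * #|U j|)%N.
    by left; apply: leq_trans big _; rewrite leq_mul2l/=; exact: US.
  right; have := @upset_step w d (a - j%:R * eta) kappa b D w0 k0 b0 degD.
  rewrite -/(U j) => /(_ (hcut _ (Upos j) small) (hdrop _ (Upos j) small)).
  have -> : a - j%:R * eta - 2 * kappa / Num.sqrt b = a - j.+1%:R * eta.
    by rewrite -/eta -natr1; ring.
  rewrite -/(U j.+1) exprSr => h.
  have h2 : rho * #|U j|%:R <= #|U j.+1|%:R - #|U j|%:R.
    rewrite -(ler_pM2l D0); apply: le_trans h; apply: le_of_eq; rewrite /rho; field; lra.
  apply: (@le_trans _ _ (#|U j|%:R * (1 + rho))); last lra.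
  by rewrite ler_wpM2r//; lra.
(* In the remaining case the level set has at least [n] elements, so it is everything, and it is
   nonempty. *)
have [//|h] := main k.
have : (n <= #|U k|)%N by rewrite -(ler_nat R); exact: le_trans h.
have := Upos k; rewrite -/(U k); lia.
Qed.

Lemma cutN w S : (forall i j, w i j = w j i) -> cut w (~: S) = cut w S.
Proof.
move=> ws; rewrite /cut exchange_big finset.setCK/=; apply: eq_bigr => i _.
by apply: eq_bigr => j _; exact: ws.
Qed.

(* The two majorities produced by [d] and [- d] intersect. *)
Lemma oscillation_bound w d (kappa b D : R) (k : nat) :
  (forall i j, 0 <= w i j) -> 0 < kappa -> 0 < b -> 0 < D ->
  (forall j, \sum_i w i j <= D) ->
  (forall S, (0 < #|S|)%N -> (2 * #|S| <= n)%N -> b * #|S|%:R <= cut w S) ->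
  (forall c, let S := upset d c in (0 < #|S|)%N -> (2 * #|S| <= n)%N ->
    cut (fun i j => w i j * (d i - d j)) S <= kappa * Num.sqrt (cut w S * #|S|%:R)) ->
  (forall c, let S := upset (- d) c in (0 < #|S|)%N -> (2 * #|S| <= n)%N ->
    cut (fun i j => w i j * (d j - d i)) S <= kappa * Num.sqrt (cut w S * #|S|%:R)) ->
  n%:R <= (1 + b / (2 * D)) ^+ k ->
  forall i j, d i - d j <= 4 * k%:R * kappa / Num.sqrt b.
Proof.
move=> w0 k0 b0 D0 degD hcut hdrop hdropN nk i j.
have Si : (0 < #|upset d (d i)|)%N by apply/card_gt0P; exists i; rewrite in_upset.
have Sj : (0 < #|upset (- d) (- d j)|)%N by apply/card_gt0P; exists j; rewrite in_upset.
have h1 := upset_majority w0 k0 b0 D0 degD hcut hdrop Si nk.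
have h2 : (n < 2 * #|upset (- d) (- d j - k%:R * (2 * kappa / Num.sqrt b))|)%N.
  apply: (upset_majority w0 k0 b0 D0 degD hcut) => // c S S1 S2.
  suff -> : (fun p q => w p q * ((- d) p - (- d) q)) =
            (fun p q => w p q * (d q - d p)) by exact: hdropN.
  by apply/funext => p; apply/funext => q; rewrite !fctE opprK addrC.
set S1 := upset _ _ in h1; set S2 := upset _ _ in h2.
have : (0 < #|S1 :&: S2|)%N.
  have := cardsUI S1 S2; have : (#|S1 :|: S2| <= n)%N by rewrite -[leqRHS]card_ord
    max_card.
  by move: h1 h2; rewrite -?/S1 -?/S2; lia.
(* The common index [l] lies at most [k] descents below [i] and at most [k] above [j]; with descents
   of length [2 * kappa / sqrt b] this gives the factor 4. *)
case/card_gt0P => l; rewrite inE !in_upset => /andP[l1 l2].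
have {}l2 : - d j - k%:R * (2 * kappa / Num.sqrt b) <= - d l by exact: l2.
have -> : 4 * k%:R * kappa / Num.sqrt b = k%:R * (2 * kappa / Num.sqrt b) * 2 by ring.
lra.
Qed.

End Cut.

(** * The likelihood restricted to a tube *)

Section PairwiseObjective.
Context {R : realType} (n : nat).
Implicit Types (u v : 'rV[R]_n).

(** Each unordered pair is counted in both orders, as in the log-likelihood before its factor one
    half. *)
Definition pairwise_objective (L : 'I_n -> 'I_n -> R -> R) v : R :=
  \sum_i \sum_(j | i != j) L i j (v 0 i - v 0 j).

(** The width 1 is the margin in [C3]: when the differences of [u] are at most [M], those of any [v]
    in the tube are at most [M + 1]. The one-sided bound over all ordered pairs is two-sided. *)
Definition anchored_tube u : set 'rV[R]_n :=
  [set v | anchored v /\ forall i j, (v 0 i - u 0 i) - (v 0 j - u 0 j) <= 1].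

(** Only boundary pairs survive, and by antisymmetry the two orders of a pair contribute equally.
    The left side is the first-order change of the objective when the coordinates in [S] move
    together. *)
Lemma antisym_cut (H : 'I_n -> 'I_n -> R) (S : {set 'I_n}) :
  (forall i j, i != j -> H j i = - H i j) ->
  \sum_i \sum_(j | i != j) H i j * ((i \in S)%:R - (j \in S)%:R) = 2 * cut H S.
Proof.
move=> Hanti.
have -> : 2 * cut H S = cut H S + cut H S by ring.
rewrite {1}cut_indicE cut_indicE [X in _ = _ + X]exchange_big -big_split/=.
apply: eq_bigr => i _; rewrite big_mkcond -big_split; apply: eq_bigr => j _ /=.
case: (eqVneq i j) => [->|ij]; first by rewrite andbN mul0r addr0.
by rewrite (Hanti _ _ ij); case: (i \in S); case: (j \in S) => /=; ring.
Qed.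

End PairwiseObjective.

(** * The maximizer over the tube: existence, score inequality, uniqueness *)

Section RestrictedMLE.
Context {R : realType} (n : nat).
Variables (L G : 'I_n -> 'I_n -> R -> R) (w : 'I_n -> 'I_n -> R).
Variables (u : 'rV[R]_n) (o : 'I_n).
Hypothesis o0 : o = 0%N :> nat.
Hypothesis anchored_u : anchored u.
Implicit Types v : 'rV[R]_n.

Notation ell := (pairwise_objective L).

Hypothesis L_cont : forall i j, i != j -> continuous (L i j).
Hypothesis L_tangent : forall i j y z, i != j ->
  L i j z <= L i j y + G i j y * (z - y).
Hypothesis L_tangent_lt : forall i j y z, i != j -> 0 < w i j -> y != z ->
  L i j z < L i j y + G i j y * (z - y).
Hypothesis G_anti : forall i j y, i != j -> G j i (- y) = - G i j y.

(** Both [u] and [v] vanish at [o], so the bound on oscillations confines each coordinate of [v] to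
    a segment; the tube is a closed part of a box. *)
Lemma anchored_tube_compact : compact (anchored_tube u).
Proof.
have cbox : compact [set v : 'rV[R]_n | forall i,
  `[u 0 i - 1, u 0 i + 1]%classic (v ord0 i)].
  by apply: (@rV_compact _ _ (fun i => `[u 0 i - 1, u 0 i + 1]%classic)) => i;
    exact: segment_compact.
pose B1 : set 'rV[R]_n := [set v | v 0 o = 0].
pose B2 : set 'rV[R]_n :=
  \bigcap_(ij : 'I_n * 'I_n) [set v : 'rV[R]_n | (v 0 ij.1 - u 0 ij.1)
    - (v 0 ij.2 - u 0 ij.2) <= 1].
have cont i : continuous (fun v : 'rV[R]_n => v 0 i) by exact: coord_continuous.
have cl1 : closed B1.
  rewrite (_ : B1 = (fun v : 'rV[R]_n => v 0 o) @^-1` [set x | x = 0])//.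
  by apply: preimage_closed => [v _|]; [exact: cont|exact: closed_eq].
have cl2 : closed B2.
  apply: closed_bigI => -[i j] _ /=.
  rewrite (_ : [set _ | _] = (fun v : 'rV[R]_n => (v 0 i - u 0 i) - (v 0 j - u 0 j))
     @^-1` [set x | x <= 1])//.
  apply: preimage_closed => [v _|]; last exact: closed_le.
  have FF := @nbhs_filter _ v.
  by apply: cvgB; apply: cvgB; try exact: cvg_cst; exact: cont.
have -> : anchored_tube u = [set v : 'rV[R]_n | forall i,
  `[u 0 i - 1, u 0 i + 1]%classic (v ord0 i)]
    `&` (B1 `&` B2).
  apply/seteqP; split => v /=.
    move=> [av vt]; split; last by split => [|ij _]; [exact: av|exact: vt].
    move=> i /=; rewrite in_itv/=.
    by have := vt i o; have := vt o i; rewrite (av o o0) (anchored_u o0); lra.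
  move=> [_ [vo vt]]; split=> [i i0|i j]; last exact: (vt (i, j) I).
  by rewrite (_ : i = o)//; apply: val_inj; rewrite /= i0 o0.
by apply: compact_closedI => //; exact: closedI.
Qed.

Lemma pairwise_objective_continuous : continuous ell.
Proof.
apply: (@continuous_big R _ +%R 0 _ (@add_continuous R)) => i _.
apply: (@continuous_big R _ +%R 0 _ (@add_continuous R)) => j ij.
move=> v.
apply: (@continuous_comp _ _ _ (fun v : 'rV[R]_n => v 0 i - v 0 j) (L i j)).
  have FF := @nbhs_filter _ v.
  by apply: cvgB; exact: coord_continuous.
exact: L_cont.
Qed.

Lemma anchored_tube_max :
  exists2 v, anchored_tube u v & forall v', anchored_tube u v' -> ell v' <= ell v.
Proof.
have t0 : anchored_tube u !=set0.
  by exists u; split=> // i j; rewrite !subrr; lra.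
have [|c + cmax] := @EVT_max_rV R n ell (anchored_tube u) t0 anchored_tube_compact.
  by apply: continuous_subspaceT; exact: pairwise_objective_continuous.
by rewrite inE => tc; exists c => // v' tv'; apply: cmax; rewrite inE.
Qed.

Section Maximizer.
Variable v : 'rV[R]_n.
Hypothesis v_tube : anchored_tube u v.
Hypothesis v_max : forall v', anchored_tube u v' -> ell v' <= ell v.
Hypothesis w_ge0 : forall i j, 0 <= w i j.

Let d i := v 0 i - u 0 i.

Section Drop.
Variables c3 M : R.
Hypothesis u_range : forall i j, `|u 0 i - u 0 j| <= M.
Hypothesis c3_ge0 : 0 <= c3.
Hypothesis G_slope : forall i j y z, i != j -> `|y| <= M + 1 -> `|z| <= M + 1 ->
  y <= z -> c3 * w i j * (z - y) <= G i j y - G i j z.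

(* Lowering the coordinates in an upper set of [v - u] keeps [v] in the tube,
   so the score summed over the boundary of that set is nonnegative. *)
Lemma tube_max_drop (S : {set 'I_n}) :
  (forall i j, i \in S -> j \in ~: S -> d j < d i) ->
  c3 * cut (fun i j => w i j * (d i - d j)) S <= cut (fun i j => G i j (u 0 i - u 0 j)) S.
Proof.
move=> Sup.
(* The smallest drop across the boundary, capped at 1. Lowering [S] by at most [g0] reverses no
   order across the boundary, so the oscillation stays at most 1. *)
pose g0 := \big[Num.min/1]_(ij : 'I_n * 'I_n | (ij.1 \in S) && (ij.2 \in ~: S))
  (d ij.1 - d ij.2).
have g0_gt0 : 0 < g0.
  by apply: lt_bigmin => // -[i j] /andP[iS jS]; rewrite subr_gt0 Sup.
have g0_le i j : i \in S -> j \in ~: S -> g0 <= d i - d j.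
  move=> iS jS; apply: (bigmin_le_cond _ (fun ij : 'I_n * 'I_n => d ij.1 - d ij.2)
    (j := (i, j))).
  by rewrite /= iS jS.
have g0_le1 : g0 <= 1 by exact: bigmin_le_id.
(* The score is controlled at the lowered point rather than at [v]; this costs a term linear in [e],
   removed at the end by taking [e] small. *)
have key e : 0 < e -> e <= g0 ->
    c3 * cut (fun i j => w i j * (d i - d j)) S - e * (c3 * cut w S) <=
    cut (fun i j => G i j (u 0 i - u 0 j)) S.
  move=> e0 eg0.
  pose s (i : 'I_n) : R := (i \in S)%:R.
  (* The constant [e * s o] restores the anchoring when [o] belongs to [S]; it cancels in all
     differences. *)
  pose v' : 'rV[R]_n := \row_i (v 0 i - e * s i + e * s o).
  have dv' i j : v' 0 i - v' 0 j = v 0 i - v 0 j - e * (s i - s j) by rewrite !mxE; ring.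
  have v't : anchored_tube u v'.
    split=> [i i0|i j].
      have -> : i = o by apply: val_inj; rewrite /= i0 o0.
      by rewrite mxE (v_tube.1 o o0); ring.
    have -> : v' 0 i - u 0 i - (v' 0 j - u 0 j) = (d i - d j) - e * (s i - s j).
      by rewrite !mxE /d; ring.
    have dij1 : d i - d j <= 1 := v_tube.2 i j.
    rewrite /s; case: (boolP (i \in S)) => iS; case: (boolP (j \in S)) => jS //=; try lra.
    have : g0 <= d j - d i by apply: g0_le => //; rewrite finset.in_setC.
    by lra.
  have /v_max le1 := v't.
  (* The tangent is taken at the lowered point; together with the maximality of [v] this makes the
     score there nonnegative without differentiating the objective. *)
  have : ell v <= ell v' + e * (2 * cut (fun i j => G i j (v' 0 i - v' 0 j)) S).
    rewrite -antisym_cut => [|i j ij]; last by rewrite -G_anti// opprB.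
    rewrite mulr_sumr /pairwise_objective -big_split; apply: ler_sum => i _.
    rewrite mulr_sumr -big_split; apply: ler_sum => j ij /=.
    apply: le_trans (L_tangent (v' 0 i - v' 0 j) _ ij) _.
    by rewrite lerD2l [in X in _ * X]dv' -/(s i) -/(s j); apply: le_of_eq; ring.
  move=> le2; have {le1 le2} ge0 : 0 <= cut (fun i j => G i j (v' 0 i - v' 0 j)) S.
    by rewrite -(pmulr_rge0 _ (_ : 0 < e * 2)) ?mulr_gt0// -mulrA; lra.
  apply: le_trans (_ : cut (fun i j => G i j (u 0 i - u 0 j)) S -
    cut (fun i j => G i j (v' 0 i - v' 0 j)) S <= _); last lra.
  rewrite /cut !mulr_sumr -!sumrB; apply: ler_sum => i iS.
  rewrite !mulr_sumr -!sumrB; apply: ler_sum => j jS.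
  have ij : i != j by apply: contraTneq jS => <-; rewrite finset.in_setC iS.
  have v'E : v' 0 i - v' 0 j = (u 0 i - u 0 j) + (d i - d j - e).
    rewrite dv' /s iS; move: jS; rewrite finset.in_setC => /negbTE ->.
    by rewrite /d /= subr0 mulr1; ring.
  have := g0_le _ _ iS jS; have : d i - d j <= 1 := v_tube.2 i j.
  have := u_range i j; rewrite ler_norml => /andP[u1 u2] dle dge.
  have := @G_slope i j (u 0 i - u 0 j) (v' 0 i - v' 0 j) ij.
  rewrite !ler_norml v'E => /(_ _ _ _).
  move=> H; have {H} := H ltac:(lra) ltac:(lra) ltac:(lra).
  by apply: le_trans; apply: le_of_eq; ring.
rewrite leNgt; apply/negP => lt.
set A := c3 * cut _ _ in key lt; set B := cut (fun i j => G i j _) S in key lt.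
have W0 : 0 <= c3 * cut w S.
  by apply: mulr_ge0 => //; apply: sumr_ge0 => i _; apply: sumr_ge0.
set W := c3 * cut w S in key W0.
(* Small enough for the error [e * W] to be at most half of the supposed gap [A - B]; the summand 1
   keeps the denominator positive. *)
pose e := Num.min g0 ((A - B) / (2 * (W + 1))).
have e0 : 0 < e by rewrite lt_min g0_gt0/= divr_gt0// ?subr_gt0//; lra.
have := key e e0; rewrite ge_min lexx => /(_ isT).
have : e * W <= (A - B) / 2.
  apply: (@le_trans _ _ ((A - B) / (2 * (W + 1)) * (W + 1))).
    by apply: ler_pM => //; [exact: ltW|rewrite ge_min lexx orbT|lra].
  by apply: le_of_eq; field; lra.
lra.
Qed.

End Drop.

Hypothesis w_sym : forall i j, w i j = w j i.
Hypothesis w_conn : forall S : {set 'I_n}, (0 < #|S|)%N -> (2 * #|S| <= n)%N ->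
  0 < cut w S.
Hypothesis d_lt1 : forall i j, d i - d j < 1.

(** Since the constraint is inactive at [v], a point [z] of the segment towards [v'], close to [v],
    is still in the tube. If [v'] did at least as well as [v], strict concavity would give [z] a
    larger value than [v]. *)
Lemma tube_max_unique v' : anchored v' -> v' != v -> ell v' < ell v.
Proof.
move=> av' v'v; rewrite ltNge; apply/negP => le1.
pose e i := v' 0 i - v 0 i.
have eo : e o = 0 by rewrite /e (av' _ o0) (v_tube.1 _ o0) subrr.
pose s0 := \big[Num.min/1]_(ij : 'I_n * 'I_n) (1 - (d ij.1 - d ij.2)).
have s0_gt0 : 0 < s0.
  by apply: lt_bigmin => // -[i j] _ /=; rewrite subr_gt0.
have s0_le i j : s0 <= 1 - (d i - d j).
  by apply: (bigmin_le_cond _ (fun ij : 'I_n * 'I_n => 1 - (d ij.1 - d ij.2))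
    (isT : xpredT (i, j))).
have s0_le1 : s0 <= 1 by exact: bigmin_le_id.
pose E := 1 + \sum_i \sum_j `|e i - e j|.
have E1 : 1 <= E by rewrite lerDl; apply: sumr_ge0 => i _; apply: sumr_ge0.
have E_ge i j : e i - e j <= E.
  apply: le_trans (ler_norm _) _; rewrite /E.
  rewrite (bigD1 i)//= (bigD1 j)//=.
  have : 0 <= \sum_(k | k != j) `|e i - e k| by apply: sumr_ge0.
  have : 0 <= \sum_(k | k != i) \sum_l `|e k - e l| by apply: sumr_ge0 => k _; apply:
    sumr_ge0.
  lra.
(* [s0] is the least slack of the constraints, and [E] bounds all increments of [e], so moving by
   [t] uses at most half of the slack. *)
pose t := s0 / (2 * E).
have t0 : 0 < t by rewrite divr_gt0//; lra.
have tE : t * E = s0 / 2 by rewrite /t; field; lra.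
have t1 : t < 1.
  have : t * 1 <= t * E by rewrite ler_wpM2l// ltW.
  by lra.
pose z : 'rV[R]_n := \row_i (v 0 i + t * e i).
have zE i j : z 0 i - z 0 j = (v 0 i - v 0 j) + t * (e i - e j) by rewrite !mxE; ring.
have zt : anchored_tube u z.
  split=> [i i0|i j].
    have -> : i = o by apply: val_inj; rewrite /= i0 o0.
    by rewrite mxE eo (v_tube.1 _ o0); ring.
  have -> : z 0 i - u 0 i - (z 0 j - u 0 j) = d i - d j + t * (e i - e j).
    by rewrite !mxE /d; ring.
  have : t * (e i - e j) <= t * E by rewrite ler_wpM2l// ltW.
  have := s0_le i j; lra.
have /v_max lez := zt.
(* The zero set of [e] contains [o] and is not everything; the smaller of it and its complement has
   a positive cut, so some compared pair has distinct increments. *)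
have [i0 [j0 [wij eij]]] : exists i j, 0 < w i j /\ e i != e j.
  pose S : {set 'I_n} := [set i | e i == 0]%SET.
  have oS : o \in S by rewrite inE eo.
  have cS : 0 < cut w S.
    have [S2|S2] := leqP (2 * #|S|) n.
      by apply: w_conn => //; apply/card_gt0P; exists o.
    rewrite -cutN//; have := cardsC S; rewrite card_ord => cSC.
    apply: w_conn; last lia.
    have : (~: S != finset.set0)%SET.
      apply: contra v'v => /eqP SC0; apply/eqP/rowP => i.
      have : i \notin ~: S by rewrite SC0 finset.in_set0.
      rewrite finset.in_setC negbK inE /e subr_eq0 => /eqP.
      by [].
    by rewrite -card_gt0.
  apply: contrapT => /forallNP H; move: cS; rewrite lt_neqAle => /andP[/eqP cS _].
  apply: cS; rewrite /cut big1// => i iS; rewrite big1// => j jS.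
  apply/eqP; rewrite eq_le w_ge0 andbT leNgt; apply/negP => wij; apply: (H i).
  exists j; split=> //; move: iS jS; rewrite finset.in_setC !inE => /eqP ->.
  by rewrite eq_sym.
have ij0 : i0 != j0 by apply: contraNneq eij => ->.
(* The concavity gap of a single pair: never negative, and positive at the pair just found. *)
pose h i j := L i j (z 0 i - z 0 j) - (1 - t) * L i j (v 0 i - v 0 j)
  - t * L i j (v' 0 i - v' 0 j).
have v'E i j : v' 0 i - v' 0 j = (v 0 i - v 0 j) + (e i - e j) by rewrite /e; ring.
have h_ge0 i j : i != j -> 0 <= h i j.
  move=> ij; have h1 := L_tangent (z 0 i - z 0 j) (v 0 i - v 0 j) ij.
  have h2 := L_tangent (z 0 i - z 0 j) (v' 0 i - v' 0 j) ij.
  set Gz := G i j _ in h1 h2.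
  have {}h1 : (1 - t) * L i j (v 0 i - v 0 j) <= (1 - t)
    * (L i j (z 0 i - z 0 j) + Gz * (- t * (e i - e j))).
    apply: ler_wpM2l; first lra.
    by apply: le_trans h1 _; rewrite lerD2l zE; apply: le_of_eq; ring.
  have {}h2 : t * L i j (v' 0 i - v' 0 j) <= t *
    (L i j (z 0 i - z 0 j) + Gz * ((1 - t) * (e i - e j))).
    apply: ler_wpM2l; first lra.
    by apply: le_trans h2 _; rewrite lerD2l zE v'E; apply: le_of_eq; ring.
  by rewrite /h; lra.
have h_gt0 : 0 < h i0 j0.
  have nz : e i0 - e j0 != 0 by rewrite subr_eq0.
  have zv : z 0 i0 - z 0 j0 != v 0 i0 - v 0 j0.
    by rewrite zE -subr_eq0 addrAC subrr add0r mulf_neq0// gt_eqF.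
  have h1 := L_tangent_lt ij0 wij zv.
  have h2 := L_tangent (z 0 i0 - z 0 j0) (v' 0 i0 - v' 0 j0) ij0.
  set Gz := G i0 j0 _ in h1 h2.
  have {}h1 : (1 - t) * L i0 j0 (v 0 i0 - v 0 j0) < (1 - t)
    * (L i0 j0 (z 0 i0 - z 0 j0) + Gz * (- t * (e i0 - e j0))).
    rewrite ltr_pM2l; last lra.
    apply: lt_le_trans h1 _.
    by rewrite lerD2l zE; apply: le_of_eq; ring.
  have {}h2 : t * L i0 j0 (v' 0 i0 - v' 0 j0) <=
    t * (L i0 j0 (z 0 i0 - z 0 j0) + Gz * ((1 - t) * (e i0 - e j0))).
    apply: ler_wpM2l; first lra.
    by apply: le_trans h2 _; rewrite lerD2l zE v'E; apply: le_of_eq; ring.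
  by rewrite /h; lra.
have : 0 < \sum_i \sum_(j | i != j) h i j.
  rewrite (bigD1 i0)//= (bigD1 j0)//=.
  apply: ltr_pwDl; last first.
    by apply: sumr_ge0 => i _; apply: sumr_ge0 => j; exact: h_ge0.
  by apply: ltr_pwDl => //; apply: sumr_ge0 => j /andP[ij _]; exact: h_ge0.
have -> : \sum_i \sum_(j | i != j) h i j = ell z - (1 - t) * ell v - t * ell v'.
  rewrite /pairwise_objective !mulr_sumr -!sumrB; apply: eq_bigr => i _.
  by rewrite !mulr_sumr -!sumrB.
have : t * ell v <= t * ell v' by rewrite ler_wpM2l// ltW.
lra.
Qed.

End Maximizer.

End RestrictedMLE.

(** * Sub-gaussian moment generating functions *)

Section ExpInequalities.
Context {R : realType}.
Implicit Types a b x z t l : R.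

Lemma expR_le_quad b : expR b <= 1 + b + b ^+ 2 * expR `|b|.
Proof.
have h1 : expR b - 1 <= b * expR b.
  have := ler_wpM2l (expR_ge0 b) (expR_ge1Dx (- b)).
  by rewrite -expRD subrr expR0; lra.
have h2 := expR_ge1Dx b.
have [b0|b0] := leP 0 b; [rewrite ger0_norm//|rewrite ltr0_norm//].
  have : b * (expR b - 1) <= b * (b * expR b) by exact: ler_wpM2l.
  by rewrite expr2; lra.
have h3 : - b * (1 - expR b) <= - b * - b by apply: ler_wpM2l; lra.
have h4 : b ^+ 2 * 1 <= b ^+ 2 * expR (- b).
  by apply: ler_wpM2l; [exact: sqr_ge0|rewrite -expR0 ler_expR; lra].
by move: h3 h4; rewrite expr2; lra.
Qed.

Lemma expR_half_le2 : expR (1 / 2 : R) <= 2.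
Proof.
rewrite -[leLHS]invrK -[leRHS]invrK -expRN lef_pV2 ?posrE ?invr_gt0 ?expR_gt0//.
by have := expR_ge1Dx (- (1 / 2) : R); lra.
Qed.

(** Half of the exponent [x ^+ 2] absorbs the factor [x ^+ 2], the other half absorbs [expR |x|]
    through [|x| <= x ^+ 2 / 2 + 1 / 2]. *)
Lemma sqr_expR_le x : x ^+ 2 * expR `|x| <= 4 * expR (x ^+ 2).
Proof.
have h1 : x ^+ 2 <= 2 * expR (x ^+ 2 / 2) by have := expR_ge1Dx (x ^+ 2 / 2); lra.
have h2 : expR `|x| <= expR (x ^+ 2 / 2) * expR (1 / 2).
  rewrite -expRD ler_expR -[x ^+ 2]real_normK ?num_real//.
  by have := sqr_ge0 (`|x| - 1); rewrite expr2; lra.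
have h3 := expR_half_le2.
have -> : expR (x ^+ 2) = expR (x ^+ 2 / 2) * expR (x ^+ 2 / 2).
  by rewrite -expRD; congr expR; field.
have e0 : 0 <= expR (x ^+ 2 / 2) by exact: expR_ge0.
apply: (@le_trans _ _ (2 * expR (x ^+ 2 / 2) * (expR (x ^+ 2 / 2) * 2))).
  apply: ler_pM; rewrite ?sqr_ge0 ?expR_ge0//.
  by apply: le_trans h2 _; exact: ler_wpM2l.
by lra.
Qed.

(** The linear term is kept exactly, so that it integrates to 0 for a centered variable. *)
Lemma expR_subgaussian_small l z t : 0 < t -> `|l * t| <= 1 ->
  expR (l * z) <= 1 + l * z + 4 * (l * t) ^+ 2 * expR (z ^+ 2 / t ^+ 2).
Proof.
move=> t0 lt1; apply: le_trans (expR_le_quad _) _.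
rewrite lerD2l.
set x := z / t; set a := l * t in lt1 *.
have -> : l * z = a * x by rewrite /a /x; field; rewrite gt_eqF.
have -> : z ^+ 2 / t ^+ 2 = x ^+ 2 by rewrite /x expr_div_n.
have h : x ^+ 2 * expR `|a * x| <= 4 * expR (x ^+ 2).
  apply: le_trans (sqr_expR_le x); apply: ler_wpM2l; first exact: sqr_ge0.
  by rewrite ler_expR normrM ler_piMl.
by have := ler_wpM2l (sqr_ge0 a) h; rewrite [(a * x) ^+ 2]exprMn; lra.
Qed.

Lemma expR_subgaussian_large l z t : 0 < t ->
  expR (l * z) <= expR ((l * t) ^+ 2) * expR (z ^+ 2 / t ^+ 2).
Proof.
move=> t0; rewrite -expRD ler_expR -expr_div_n.
set x := z / t; set a := l * t.
have -> : l * z = a * x by rewrite /a /x; field; rewrite gt_eqF.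
have := sqr_ge0 (a - x); have := sqr_ge0 (a + x); rewrite !expr2; lra.
Qed.

End ExpInequalities.

(** * Probability densities and moment generating functions under them *)

Section Density.
Context {d : measure_display} {T : measurableType d} {R : realType}.
Variables (mu : {measure set T -> \bar R}) (D : set T) (phi : T -> R).
Hypothesis mD : measurable D.
Hypothesis phi_gt0 : forall x, D x -> 0 < phi x.
Hypothesis mphi : measurable_fun D phi.
Hypothesis phi1 : (\int[mu]_(x in D) (phi x)%:E = 1)%E.

Lemma density_integrable : mu.-integrable D (EFin \o phi).
Proof.
apply/integrableP; split; first exact/measurable_EFinP.
rewrite (eq_integral (fun x => (phi x)%:E)) ?phi1 ?ltry// => x.
by rewrite inE => Dx /=; rewrite ger0_norm// ltW// phi_gt0.
Qed.

(** Were the integrals equal, the positive function [psi - phi] would vanish almost everywhere on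
    [D]; then so would [phi], whose mass is 1. *)
Lemma density_lt (psi : T -> R) : mu.-integrable D (EFin \o psi) ->
  (forall x, D x -> phi x < psi x) -> (1 < \int[mu]_(x in D) (psi x)%:E)%E.
Proof.
move=> ipsi lt; rewrite lt_neqAle; apply/andP; split; last first.
  rewrite -phi1; apply: le_integral => //; first exact: density_integrable.
  by move=> x; rewrite inE => Dx; rewrite lee_fin ltW// lt.
apply/eqP => psi1.
have idiff : mu.-integrable D ((EFin \o psi) \- (EFin \o phi))%E.
  by apply: integrableB => //; exact: density_integrable.
have I0 : (\int[mu]_(x in D) ((EFin \o psi) \- (EFin \o phi))%E x = 0)%E.
  by rewrite integralB_EFin//; [rewrite -psi1 phi1 subee|exact: density_integrable].
have : ae_eq mu D ((EFin \o psi) \- (EFin \o phi))%E (cst 0%E).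
  apply/ae_eq_integral_abs => //; first exact: measurable_int idiff.
  rewrite -[RHS]I0; apply: eq_integral => x; rewrite inE => Dx /=.
  by rewrite ger0_norm// subr_ge0 ltW// lt.
move=> ae0.
have aeF : ae_eq mu D (EFin \o phi) (cst 0%E).
  apply: filterS ae0 => x /= /[swap] Dx => /(_ Dx) [] /eqP.
  by rewrite subr_eq0 gt_eqF ?lt.
have := phi1; rewrite (ae_eq_integral (cst 0%E))//; last exact/measurable_EFinP.
by rewrite integral0 => -[] /eqP; rewrite eq_sym oner_eq0.
Qed.

Variable (Z : T -> R).
Hypothesis mZ : measurable_fun D Z.

Section PsiTwo.
Variable (t : R).
Hypothesis t0 : 0 < t.
Hypothesis psi2 : (\int[mu]_(x in D) ((expR (Z x ^+ 2 / t ^+ 2))%:E * (phi x)%:E) <=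
  2%:E)%E.

Let q x := expR (Z x ^+ 2 / t ^+ 2) * phi x.

Lemma measurable_psi2 : measurable_fun D q.
Proof.
apply: measurable_funM => //; apply: measurableT_comp => //.
by apply: measurable_funM => //; exact: measurable_funX.
Qed.

Lemma psi2_integrable : mu.-integrable D (EFin \o q).
Proof.
apply/integrableP; split; first by apply/measurable_EFinP; exact: measurable_psi2.
apply: (@le_lt_trans _ _ 2%:E); last exact: ltry.
apply: le_trans psi2; rewrite le_eqVlt; apply/predU1P; left.
apply: eq_integral => x; rewrite inE => Dx.
have p0 := phi_gt0 Dx.
by rewrite gee0_abs ?lee_fin ?mulr_ge0 ?expR_ge0 ?ltW// -EFinM.
Qed.

Lemma psi2_dominated (h : T -> R) (c : R) : measurable_fun D h ->
  (forall x, D x -> `|h x| <= c * expR (Z x ^+ 2 / t ^+ 2)) ->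
  mu.-integrable D (fun x => (h x * phi x)%:E).
Proof.
move=> mh hle.
have := integrableZl mD c psi2_integrable.
apply: le_integrable => //.
  by apply/measurable_EFinP; exact: measurable_funM.
move=> x Dx; have p0 := phi_gt0 Dx.
rewrite /= lee_fin [leLHS]normrM (gtr0_norm p0).
apply: le_trans (ler_norm _); rewrite mulrA.
by apply: ler_wpM2r; [exact: ltW|exact: hle].
Qed.

Lemma expR_integrable l : mu.-integrable D (fun x => (expR (l * Z x) * phi x)%:E).
Proof.
apply: (@psi2_dominated _ (expR ((l * t) ^+ 2))).
  by apply: measurableT_comp => //; exact: measurable_funM.
by move=> x Dx; rewrite ger0_norm ?expR_ge0//; exact: expR_subgaussian_large.
Qed.

Lemma norm_le_psi2 z : `|z| <= t * expR (z ^+ 2 / t ^+ 2).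
Proof.
have -> : z ^+ 2 / t ^+ 2 = (`|z| / t) ^+ 2 by rewrite expr_div_n real_normK ?num_real.
have {1}-> : `|z| = t * (`|z| / t) by field; rewrite gt_eqF.
apply: ler_wpM2l; first exact: ltW.
apply: le_trans (expR_ge1Dx _); move: (`|z| / t) => s.
by have := sqr_ge0 (s - 1); have := sqr_ge0 s; rewrite !expr2; lra.
Qed.

Lemma shift_integrable c : mu.-integrable D (fun x => ((Z x + c) * phi x)%:E).
Proof.
apply: (@psi2_dominated _ (t + `|c|)); first exact: measurable_funD.
move=> x Dx; apply: le_trans (ler_normD _ _) _; rewrite mulrDl lerD//.
  exact: norm_le_psi2.
apply: ler_peMr => //; rewrite -expR0 ler_expR.
by rewrite divr_ge0// sqr_ge0.
Qed.

(** For [|l * t| <= 1] the second-order bound gives [1 + 8 * (l * t) ^+ 2]. Otherwise the crude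
    bound [2 * expR ((l * t) ^+ 2)] is enough, since then 2 is at most [expR ((l * t) ^+ 2)]. *)
Lemma subgaussian_mgf l : (\int[mu]_(x in D) (Z x * phi x)%:E = 0)%E ->
  (\int[mu]_(x in D) (expR (l * Z x) * phi x)%:E <= (expR (8 * (l * t) ^+ 2))%:E)%E.
Proof.
move=> Z0.
have Iq : (\int[mu]_(x in D) (EFin \o q) x <= 2%:E)%E by [].
have [lt1|lt1] := leP `|l * t| 1; last first.
  apply: (@le_trans _ _ (\int[mu]_(x in D) ((expR ((l * t) ^+ 2))%:E * (EFin \o q)
    x)%E)%E).
    apply: le_integral => //; first exact: expR_integrable.
      exact: integrableZl psi2_integrable.
    move=> x; rewrite inE => Dx; rewrite -EFinM lee_fin /q mulrA.
    by apply: ler_wpM2r; [exact/ltW/phi_gt0|exact: expR_subgaussian_large].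
  rewrite integralZl//; last exact: psi2_integrable.
  apply: (@le_trans _ _ ((expR ((l * t) ^+ 2))%:E * 2%:E)%E).
    by apply: lee_wpmul2l => //; rewrite lee_fin expR_ge0.
  rewrite -EFinM lee_fin.
  have l1 : 1 <= (l * t) ^+ 2.
    by rewrite -[leRHS]real_normK ?num_real// expr_ge1// ltW.
  have := expR_ge1Dx ((l * t) ^+ 2) => h.
  apply: (@le_trans _ _ (expR ((l * t) ^+ 2) * expR ((l * t) ^+ 2))).
    by apply: ler_wpM2l; [exact: expR_ge0|lra].
  by rewrite -expRD ler_expR; lra.
pose c := 4 * (l * t) ^+ 2.
have c0 : 0 <= c by rewrite mulr_ge0// sqr_ge0.
have iZ : mu.-integrable D (fun x => (Z x * phi x)%:E).
  have := shift_integrable 0; apply: eq_integrable => // x _.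
  by rewrite addr0.
have i1 : mu.-integrable D (fun x => (l%:E * (Z x * phi x)%:E)%E) by exact:
  integrableZl iZ.
have i2 : mu.-integrable D (fun x => (c%:E * (EFin \o q) x)%E).
  exact: integrableZl psi2_integrable.
have i3 : mu.-integrable D (fun x => ((EFin \o phi) x + l%:E * (Z x * phi x)%:E)%E).
  by apply: integrableD => //; exact: density_integrable.
apply: (@le_trans _ _ (\int[mu]_(x in D) (((EFin \o phi) x + l%:E * (Z x * phi x)%:E) +
  c%:E * (EFin \o q) x)%E)%E).
  apply: le_integral => //; first exact: expR_integrable.
    exact: integrableD.
  move=> x; rewrite inE => Dx /=; rewrite -!EFinM -!EFinD lee_fin /q.
  have := ler_wpM2r (ltW (phi_gt0 Dx)) (expR_subgaussian_small (Z x) t0 lt1).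
  by rewrite -/c !mulrDl mul1r; rewrite -!mulrA.
rewrite integralD// integralD//; last exact: density_integrable.
rewrite phi1 integralZl// integralZl//; last exact: psi2_integrable.
rewrite Z0 mule0 adde0.
apply: (@le_trans _ _ (1 + c%:E * 2%:E)%E).
  by rewrite leeD2l// lee_wpmul2l// lee_fin.
rewrite -EFinM -EFinD lee_fin; apply: le_trans (expR_ge1Dx _) ; rewrite /c; lra.
Qed.

End PsiTwo.
End Density.

(** * Score of the link function *)

Section Calculus.
Context {R : realType}.
Implicit Types (L G : R -> R).

Lemma is_derive_MVT L G y z : (forall x : R, is_derive x 1 L (G x)) -> y < z ->
  exists c, [/\ y < c, c < z & L z - L y = G c * (z - y)].
Proof.
move=> dL yz.
have cL : {within `[y, z], continuous L}.
  by apply: derivable_within_continuous => x _; apply: ex_derive.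
have [c] := @MVT R L G y z yz (fun x _ => dL x) cL.
by rewrite in_itv/= => /andP[yc cz] E; exists c.
Qed.

Lemma concave_tangent_lt L G y z : (forall x : R, is_derive x 1 L (G x)) ->
  {homo G : a b / a < b >-> b < a} -> y != z -> L z < L y + G y * (z - y).
Proof.
move=> dL Gdec; rewrite neq_lt => /orP[yz|zy].
  have [c [yc cz E]] := is_derive_MVT dL yz.
  have : G c * (z - y) < G y * (z - y) by rewrite ltr_pM2r ?subr_gt0// Gdec.
  lra.
have [c [zc cy E]] := is_derive_MVT dL zy.
have : G y * (y - z) < G c * (y - z) by rewrite ltr_pM2r ?subr_gt0// Gdec.
lra.
Qed.

(** A derivative as the limit of a sequence of difference quotients; this yields the measurability
    of the score in [x]. *)
Lemma derive1_cvg_seq L y : derivable L y 1 ->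
  (L (m.+1%:R^-1 + y) - L y) * m.+1%:R @[m --> \oo] --> derive1 L y.
Proof.
move=> dL.
have seq0 : (m.+1%:R^-1 : R) @[m --> \oo] --> (0 : R)^'.
  move=> P /= nP; have {}nP : \forall x \near (0 : R), x != 0 -> P x := nP.
  have {}nP : \forall m \near \oo, (m.+1%:R^-1 : R) != 0 -> P m.+1%:R^-1.
    exact: (@cvg_harmonic R _ nP).
  suff : \forall m \near \oo, P m.+1%:R^-1 by [].
  by apply: filterS nP => m; apply; rewrite gt_eqF// invr_gt0.
have c1 : (h^-1 *: (L (h + y) - L y)) @[h --> (0:R)^'] --> derive1 L y.
  rewrite /derive1; move: dL; rewrite /derivable.
  rewrite (_ : (fun h => h^-1 *: _) = (fun h => h^-1 *: (L (h + y) - L y)))//.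
  by apply/funext => h; rewrite /= [h *: _]mulr1.
have := cvg_comp _ _ seq0 c1; apply: cvg_trans; apply: near_eq_cvg.
by apply: nearW => m /=; rewrite invrK mulrC.
Qed.

End Calculus.

Section Link.
Context {R : realType}.
Variables (k : domain_kind) (A : set R) (f : R -> R -> R).
Hypothesis fdom : link_domain k A.
Hypothesis fval : valid_link k A f.
Hypothesis fslc : strictly_log_concave A f.
Notation mu := (base_measure k).
Notation g := (glink f).

Lemma link_domain_measurable : measurable (A : set (measurableTypeR R)).
Proof.
case: fdom => _; case: k => //= cA.
by apply: countable_measurable cA => t; exact: measurable_set1.
Qed.
Let mA := link_domain_measurable.

Lemma ln_link_derive (x y : R) : A x -> is_derive y 1 (fun z => ln (f x z)) (g x y).
Proof.
move=> Ax; have [d1 _ _] := fslc y Ax.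
by apply: (DeriveDef d1); rewrite -derive1E.
Qed.

Lemma glink_derive (x y : R) : A x -> is_derive y 1 (g x) (glink2 f x y).
Proof.
move=> Ax; have [_ d1 _] := fslc y Ax.
by apply: (DeriveDef d1); rewrite -derive1E.
Qed.

Lemma glink_decr x y z : A x -> y < z -> g x z < g x y.
Proof.
move=> Ax yz; have [c [_ _ E]] := is_derive_MVT (fun y => glink_derive y Ax) yz.
have [_ _ g2] := fslc c Ax.
have : glink2 f x c * (z - y) < 0 by rewrite nmulr_rlt0// subr_gt0.
lra.
Qed.

Lemma ln_link_tangent x y z : A x -> y != z ->
  ln (f x z) < ln (f x y) + g x y * (z - y).
Proof.
move=> Ax; apply: (concave_tangent_lt (fun y => ln_link_derive y Ax)) => a b.
exact: glink_decr.
Qed.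

Lemma glink_slope x y z c M : A x -> `|y| <= M -> `|z| <= M -> y <= z ->
  (forall s, `|s| <= M -> c <= `|glink2 f x s|) -> c * (z - y) <= g x y - g x z.
Proof.
move=> Ax yM zM; rewrite le_eqVlt => /predU1P[->|yz] cle; first by rewrite !subrr mulr0.
have [s [ys sz E]] := is_derive_MVT (fun y => glink_derive y Ax) yz.
have [_ _ g2] := fslc s Ax.
have /cle : `|s| <= M by move: yM zM; rewrite !ler_norml; lra.
rewrite ltr0_norm// => h.
have : c * (z - y) <= - glink2 f x s * (z - y) by rewrite ler_pM2r ?subr_gt0.
lra.
Qed.

Lemma glink_sym x y : A x -> g (- x) (- y) = - g x y.
Proof.
move=> Ax; rewrite /glink derive1E.
have -> : (fun z => ln (f (- x) z)) = (fun z => ln (f x z)) \o -%R.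
  by apply/funext => z /=; rewrite (link_sym fval (- z) Ax) opprK.
have dN : is_derive (- y) 1 (-%R : R -> R) (-1) by apply: is_deriveNid.
have dL : is_derive (- - y) 1 (fun z => ln (f x z)) (g x y).
  by rewrite opprK; exact: ln_link_derive.
have dc := is_derive1_comp dL dN; rewrite (@derive_val _ _ _ _ _ _ _ dc).
by rewrite mulrN1.
Qed.

Lemma measurable_glink y : measurable_fun (A : set (measurableTypeR R)) (g ^~ y).
Proof.
pose h m x := (ln (f x (m.+1%:R^-1 + y)) - ln (f x y)) * m.+1%:R.
apply: (@measurable_fun_cvg _ _ _ _ h) => [m|x Ax].
  apply: measurable_funM => //; apply: measurable_funB.
    by apply: measurableT_comp; [exact: measurable_ln|exact: link_measurable fval _].
  by apply: measurableT_comp; [exact: measurable_ln|exact: link_measurable fval _].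
by apply: derive1_cvg_seq; have [] := fslc y Ax.
Qed.

Notation E y h := (\int[mu]_(x in A) (h x * f x y)%:E)%E.
Let f0 y x : A x -> 0 < f x y. Proof. exact: link_gt0 fval _ _. Qed.
Let mf y := link_measurable fval y.
Let f1 y := link_integral1 fval y.

Lemma link_integrable y : mu.-integrable A (EFin \o (f ^~ y)).
Proof. by apply: density_integrable => // x; exact: f0. Qed.

(** Exponentiated tangent inequality: a shift of the parameter is dominated by the exponential tilt
    along the score. The shifted density has mass 1, so the tilt has mass more than 1 whenever it is
    integrable. *)
Lemma link_tilt_lt x y l : A x -> l != 0 -> f x (y + l) < expR (l * g x y) * f x y.
Proof.
move=> Ax l0; rewrite -ltr_ln ?posrE ?mulr_gt0 ?expR_gt0 ?f0//.
rewrite lnM ?posrE ?expR_gt0 ?f0// expRK.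
have : y != y + l by rewrite -subr_eq0 opprD addNKr oppr_eq0.
move=> /(ln_link_tangent Ax).
by rewrite (_ : y + l - y = l); [lra|ring].
Qed.

(* By concavity [f x (y + l) <= exp (l * g x y) * f x y], so the moment
   generating function of the score is at least [1]; it is differentiable
   at [0] by sub-gaussianity, hence the score is centered. *)
Lemma score_mean0 y c t : 0 < t ->
  let Z x := g x y - c in
  (link_expectation k A f y (fun s => (expR (Z s ^+ 2 / t ^+ 2))%:E) <= 2%:E)%E ->
  fine (link_expectation k A f y (fun z => (g z y)%:E)) = c -> c = 0.
Proof.
move=> t0 Z psi mean.
have mZ : measurable_fun (A : set (measurableTypeR R)) Z.
  by apply: measurable_funB => //; exact: measurable_glink.
have iZ := shift_integrable mA (f0 y) (mf y) mZ t0 psi.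
(* Sub-gaussianity of [Z] makes the score integrable, so [fine] does not return its default
   value. *)
have ig : mu.-integrable A (fun x => (g x y * f x y)%:E).
  by have := iZ c; apply: eq_integrable => // x _; rewrite /Z subrK.
have Eg : (E y (g ^~ y) = c%:E)%E.
  rewrite -mean fineK; last by rewrite /link_expectation; exact: integrable_fin_num ig.
  by [].
have Z0 : (\int[mu]_(x in A) (Z x * f x y)%:E = 0)%E.
  pose a x := g x y * f x y; pose b x := c * f x y.
  rewrite (_ : (fun x => _) = ((EFin \o a) \- (EFin \o b))%E); last first.
    by apply/funext => x; rewrite /= -EFinB /Z mulrBl.
  have if1 := link_integrable y.
  have ic : mu.-integrable A (EFin \o b).
    by have := integrableZl mA c if1; apply: eq_integrable.
  rewrite integralB_EFin// Eg (_ : integral _ _ _ = c%:E) ?subee//.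
  transitivity (\int[mu]_(x in A) (c%:E * (EFin \o (f ^~ y)) x)%E)%E; first exact:
    eq_integral.
  by rewrite integralZl// f1 mule1.
(* Both sides bound the moment generating function of [Z] at [l]: from below through the tilt, from
   above through sub-gaussianity. *)
have key l : l != 0 -> expR (- l * c) <= expR (8 * (l * t) ^+ 2).
  move=> l0; rewrite -lee_fin.
  apply: le_trans (subgaussian_mgf mA (f0 y) (mf y) (f1 y) mZ t0 psi l Z0).
  rewrite -[leLHS]mule1 -(f1 (y + l)) -integralZl//; last exact: link_integrable.
  apply: le_integral => //.
  - by apply: integrableZl => //; exact: link_integrable.
  - by apply: (@expR_integrable _ _ _ mu A (f ^~ y) mA _ _ Z mZ t) => // x; exact: f0.
  move=> x; rewrite inE => Ax; rewrite -EFinM lee_fin.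
  apply: le_trans (ler_wpM2l (expR_ge0 _) (ltW (link_tilt_lt y Ax l0))) _.
  by rewrite mulrA -expRD /Z; apply: le_of_eq; congr (expR _ * _); ring.
apply/eqP/negPn/negP => c0.
have t20 : 0 < t ^+ 2 by rewrite exprn_gt0.
(* This value of [l] maximizes [- l * c - 8 * (l * t) ^+ 2]; there the lower exponent is twice the
   upper one. *)
have nz : - c / (16 * t ^+ 2) != 0.
  by rewrite mulf_neq0 ?oppr_eq0// invr_neq0// mulf_neq0// lt0r_neq0.
have := key _ nz; rewrite ler_expR.
have -> : - (- c / (16 * t ^+ 2)) * c = 2 * (c ^+ 2 / (32 * t ^+ 2)) by field; lra.
have -> : 8 * (- c / (16 * t ^+ 2) * t) ^+ 2 = c ^+ 2 / (32 * t ^+ 2) by field;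
  rewrite gt_eqF.
have : 0 < c ^+ 2 / (32 * t ^+ 2).
  by apply: divr_gt0; [rewrite exprn_even_gt0|rewrite mulr_gt0].
lra.
Qed.

Lemma score_mgf y t l : 0 < t ->
  (link_expectation k A f y (fun s => (expR (g s y ^+ 2 / t ^+ 2))%:E) <= 2%:E)%E ->
  (E y (g ^~ y) = 0)%E ->
  (E y (fun x => expR (l * g x y)) <= (expR (8 * (l * t) ^+ 2))%:E)%E.
Proof.
move=> t0 psi g0.
exact: (subgaussian_mgf mA (f0 y) (mf y) (f1 y) (measurable_glink y) t0 psi l g0).
Qed.

(** The tilt with [l = 1]. Its strictness is what later keeps the sub-gaussian constant away from
    0. *)
Lemma score_mgf_gt1 y t : 0 < t ->
  (link_expectation k A f y (fun s => (expR (g s y ^+ 2 / t ^+ 2))%:E) <= 2%:E)%E ->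
  (1 < E y (fun x => expR (1 * g x y)))%E.
Proof.
move=> t0 psi.
have ie := expR_integrable mA (f0 y) (mf y) (measurable_glink y) t0 psi 1.
have e1 : (\int[mu]_(x in A) (f x (y + 1))%:E = 1)%E := f1 _.
exact: (density_lt mA (f0 (y + 1)) (mf (y + 1))
  e1 ie (fun x Ax => link_tilt_lt y Ax (oner_neq0 _))).
Qed.

(** The infimum defining the norm need not be attained, whence the strict [C4 < t]; the exponential
    moment decreases in [t]. *)
Lemma score_psi2_le (M C4 y t : R) : (score_psi2_sup k A f M <= C4%:E)%E ->
  `|y| <= M -> C4 < t ->
  0 < t /\
  (link_expectation k A f y (fun s => (expR (centered_score k A f y s ^+ 2 / t ^+
    2))%:E) <= 2%:E)%E.
Proof.
move=> supC yM Ct.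
have : (psi2_norm (link_expectation k A f y) (centered_score k A f y) < t%:E)%E.
  apply: (@le_lt_trans _ _ C4%:E); last by rewrite lte_fin.
  by apply: le_trans supC; apply: ereal_sup_ubound; exists y.
move=> /ereal_inf_lt[_ [s [s0 hs] <-]]; rewrite lte_fin => st.
split; first exact: lt_trans st.
apply: le_trans hs; apply: ge0_le_integral => //.
- by move=> x Ax; rewrite -EFinM lee_fin mulr_ge0 ?expR_ge0// ltW ?f0.
- apply/measurable_EFinP; apply: measurable_funM => //.
  apply: measurableT_comp => //; apply: measurable_funM => //; apply: measurable_funX.
  by apply: measurable_funB => //; exact: measurable_glink.
- apply/measurable_EFinP; apply: measurable_funM => //.
  apply: measurableT_comp => //; apply: measurable_funM => //; apply: measurable_funX.
  by apply: measurable_funB => //; exact: measurable_glink.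
move=> x Ax; rewrite -!EFinM lee_fin; apply: ler_wpM2r; first exact/ltW/f0.
rewrite ler_expR; apply: ler_wpM2l; first exact: sqr_ge0.
by rewrite lef_pV2 ?posrE ?exprn_gt0// ?(lt_trans s0)// ler_pXn2r ?nnegrE ?ltW//
  (lt_trans s0).
Qed.

Lemma score_psi2_mean0 (M C4 y t : R) : (score_psi2_sup k A f M <= C4%:E)%E ->
  `|y| <= M -> C4 < t ->
  [/\ 0 < t,
   (link_expectation k A f y (fun s => (expR (g s y ^+ 2 / t ^+ 2))%:E) <= 2%:E)%E &
   (E y (g ^~ y) = 0)%E].
Proof.
move=> supC yM Ct; have [t0 psi] := score_psi2_le supC yM Ct.
have c0 := score_mean0 t0 psi erefl.
have {}psi : (link_expectation k A f y (fun s => (expR (g s y ^+ 2 / t ^+ 2))%:E) <=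
  2%:E)%E.
  by move: psi; rewrite /centered_score c0; under eq_fun do rewrite subr0.
split=> //.
have ig : mu.-integrable A (fun x => (g x y * f x y)%:E).
  have mg := measurable_glink y.
  have : mu.-integrable A (fun x => ((g x y + 0) * f x y)%:E).
    by apply: (@shift_integrable _ _ _ mu A (f ^~ y) mA _ _ (g ^~ y) mg t) => // x;
      exact: f0.
  by apply: eq_integrable => // x _; rewrite addr0.
rewrite -[LHS]fineK; last exact: integrable_fin_num ig.
by congr (_%:E); exact: c0.
Qed.

(** A bounded score is sub-gaussian at scale [2 * c]; this lets [C2] stand in for [C4] in
    [omega]. *)
Lemma bounded_psi2 (y c : R) : 0 < c -> (forall x, A x -> `|g x y| <= c) ->
  (link_expectation k A f y (fun s => (expR (g s y ^+ 2 / (2 * c) ^+ 2))%:E) <= 2%:E)%E.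
Proof.
move=> c0 gc.
have h : expR (1 / 4 : R) <= 2.
  by apply: le_trans (@expR_half_le2 R); rewrite ler_expR; lra.
rewrite -[leRHS]mule1 -(f1 y) -integralZl//; last exact: link_integrable.
apply: ge0_le_integral => //.
- by move=> x Ax; rewrite -EFinM lee_fin mulr_ge0 ?expR_ge0// ltW ?f0.
- apply/measurable_EFinP; apply: measurable_funM => //.
  apply: measurableT_comp => //; apply: measurable_funM => //; apply: measurable_funX.
  exact: measurable_glink.
- by apply/measurable_EFinP; apply: measurable_funM.
move=> x Ax; rewrite -!EFinM lee_fin; apply: ler_wpM2r; first exact/ltW/f0.
apply: le_trans h; rewrite ler_expR ler_pdivrMr ?exprn_gt0 ?mulr_gt0//.
have : g x y ^+ 2 <= c ^+ 2.
  by rewrite -[leLHS]real_normK ?num_real// ler_pXn2r ?nnegrE ?(ltW c0)// gc.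
by rewrite exprMn; lra.
Qed.

(** [K] is either numerator of [omega], and both cases share the scale [2 * K]. The lower bound [t0]
    is chosen before [M], [C4] and [K], hence is the same for all [n]; it comes from [y = 0],
    admissible for every [M]. *)
Lemma score_subgaussian : exists2 t0 : R, 0 < t0 &
  forall M C4 K : R, 0 <= M -> (score_psi2_sup k A f M <= C4%:E)%E ->
  K = C4 \/ (forall x y, A x -> `|y| <= M -> `|g x y| <= K) ->
  t0 <= 2 * K /\
  forall y l, `|y| <= M ->
    (E y (fun x => expR (l * g x y)) <= (expR (8 * (l * (2 * K)) ^+ 2))%:E)%E.
Proof.
pose psi (t : R) := (link_expectation k A f 0 (fun s => (expR (g s 0 ^+ 2 / t ^+ 2))%:E)
  <= 2%:E)%E.
have [t0 t0_gt0 t0_le] : exists2 t0 : R, 0 < t0 &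
    forall t, 0 < t -> psi t -> (E 0 (g ^~ 0) = 0)%E -> t0 <= t.
  (* If no scale satisfies the premises at [y = 0], the bound is vacuous and 1 serves. *)
  have [[s [s0 ps e0]]|no] :=
    pselect (exists s, [/\ 0 < s, psi s & (E 0 (g ^~ 0) = 0)%E]); last first.
    by exists 1 => // t tt0 pt e0; exfalso; apply: no; exists t.
  have b1 := score_mgf_gt1 s0 ps.
  have b2 t : 0 < t -> psi t -> (E 0 (fun x => expR (1 * g x 0)) <=
    (expR (8 * (1 * t) ^+ 2))%:E)%E.
    by move=> tt0 pt; exact: score_mgf.
  move: b1 b2; set B := integral _ _ _; case: B => [b||] b1 b2; first last.
  - by move: b1; rewrite ltNge leNye.
  - by move: (b2 _ s0 ps).
  rewrite lte_fin in b1.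
  (* Solves [b <= expR (8 * t ^+ 2)] for [t], where [b > 1] is the moment generating function of the
     score at 1. *)
  exists (Num.sqrt (ln b / 8)); first by rewrite sqrtr_gt0 divr_gt0 ?ln_gt0.
  move=> t tt0 /(b2 _ tt0); rewrite mul1r lee_fin => le _.
  rewrite -[leRHS](gtr0_norm tt0) -sqrtr_sqr; apply: ler_wsqrtr; rewrite ler_pdivrMr//.
  by rewrite mulrC -(expRK (8 * _)) ler_ln ?posrE ?expR_gt0// (lt_trans ltr01).
exists t0 => // M C4 K M0 supC; case=> [->|gK].
  have tC : t0 <= C4.
    apply/ler_addgt0Pr => e e0.
    have [||p1 p2 p3] := @score_psi2_mean0 M C4 0 (C4 + e) supC; rewrite ?normr0 ?ltrDl//.
    exact: t0_le.
  split=> [|y l yM]; first lra.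
  have [|p1 p2 p3] := @score_psi2_mean0 M C4 y (2 * C4) supC yM; first lra.
  exact: score_mgf.
have mean0 y : `|y| <= M -> (E y (g ^~ y) = 0)%E.
  by move=> yM; have [|] := @score_psi2_mean0 M C4 y (C4 + 1) supC yM; rewrite ?ltrDl.
have K0 : 0 <= K.
  have [x Ax] : A !=set0.
    apply/set0P/negP => /eqP A0; have := f1 0; rewrite A0 integral_set0 => -[] /eqP.
    by rewrite eq_sym oner_eq0.
  by apply: le_trans (gK x 0 Ax _); rewrite ?normr0.
have tK : t0 <= 2 * K.
  apply/ler_addgt0Pr => e e0.
  have e20 : 0 < K + e / 2 by lra.
  have := t0_le (2 * (K + e / 2)).
  rewrite (_ : 2 * (K + e / 2) = 2 * K + e); last lra.
  apply; [lra| |by apply: mean0; rewrite normr0].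
  rewrite (_ : 2 * K + e = 2 * (K + e / 2)); last lra.
  apply: bounded_psi2 => // x Ax; apply: le_trans (gK x 0 Ax _) _; rewrite ?normr0//; lra.
split=> // y l yM; apply: score_mgf; [lra| |exact: mean0].
by apply: bounded_psi2 => [|x Ax]; [lra|exact: gK].
Qed.

End Link.

(** * Conditional law of the outcomes *)

Section WeightedPushforward.
Import HBNNSimple.
Context {R : realType} {d : measure_display} {T : measurableType d}.
Variables (mu : {measure set T -> \bar R}) (D : set T) (X : T -> R) (W : T -> R).
Hypothesis mD : measurable D.
Hypothesis mX : measurable_fun D X.
Hypothesis mW : measurable_fun D W.
Hypothesis W0 : forall x, D x -> 0 <= W x.

Lemma integral_weighted_nnsfun (h : {nnsfun (measurableTypeR R) >-> R}) :
  (\int[mu]_(x in D) (h (X x) * W x)%:E =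
   \sum_(r \in range h) (r%:E * \int[mu]_(x in D)
     (\1_(h @^-1` [set r]) (X x) * W x)%:E))%E.
Proof.
have mI r : measurable_fun D (fun x => \1_(h @^-1` [set r]) (X x) * W x).
  apply: measurable_funM => //.
  by apply: (@measurableT_comp _ _ _ _ _ _ (\1_(h @^-1` [set r]) : measurableTypeR R ->
    R)).
transitivity (\int[mu]_(x in D) (\sum_(r \in range h)
  (r * (\1_(h @^-1` [set r]) (X x) * W x))%:E))%E.
  apply: eq_integral => x _; rewrite fimfunE fsumEFin//; congr (_%:E).
  by rewrite mulr_fsuml; apply: eq_fsbigr => r _; rewrite mulrA.
rewrite ge0_integral_fsum//.
- apply: eq_fsbigr => r; rewrite inE => -[s _ <-].
  under eq_integral do rewrite EFinM.
  rewrite ge0_integralZl_EFin//.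
  - by move=> x Dx; rewrite lee_fin mulr_ge0// W0.
  - exact/measurable_EFinP.
- by move=> r; apply/measurable_EFinP; exact: measurable_funM.
- move=> r x Dx; rewrite lee_fin mulrA mulr_ge0 ?W0//.
  by have := nnfun_muleindic_ge0 h r (X x); rewrite lee_fin.
Qed.

Lemma cvg_integral_weighted (h : measurableTypeR R -> R)
  (mh : measurable_fun setT (EFin \o h)) :
  (forall x, 0 <= h x) ->
  (\int[mu]_(x in D) (nnsfun_approx measurableT mh n (X x) * W x)%:E)%E @[n --> \oo] -->
  (\int[mu]_(x in D) (h (X x) * W x)%:E)%E.
Proof.
move=> h0; pose h_ := nnsfun_approx measurableT mh.
rewrite (_ : (\int[mu]_(x in D) (h (X x) * W x)%:E)%E =
   (\int[mu]_(x in D) (limn (fun n => (h_ n (X x) * W x)%:E)))%E).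
  apply: cvg_monotone_convergence => //.
  - move=> n; apply/measurable_EFinP; apply: measurable_funM => //.
    exact: (measurableT_comp (@measurable_funPT _ _ _ _ (h_ n))).
  - by move=> n x Dx; rewrite lee_fin mulr_ge0// W0.
  - move=> x Dx m n mn; rewrite lee_fin ler_wpM2r ?W0//.
    by have /lefP := nd_nnsfun_approx measurableT mh mn; exact.
apply: eq_integral => x; rewrite inE => Dx; apply/esym/cvg_lim => //.
rewrite EFinM; under eq_fun do rewrite EFinM.
apply: cvgeZr => //; apply: (cvg_nnsfun_approx measurableT mh) => // y _.
by rewrite lee_fin.
Qed.

End WeightedPushforward.

Section IntegralTransfer.
Import HBNNSimple.
Context {R : realType} {d1 d2 : measure_display}
  {T1 : measurableType d1} {T2 : measurableType d2}.
Variables (mu1 : {measure set T1 -> \bar R}) (mu2 : {measure set T2 -> \bar R}).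
Variables (D1 : set T1) (D2 : set T2) (X1 W1 : T1 -> R) (X2 W2 : T2 -> R).
Hypotheses (mD1 : measurable D1) (mD2 : measurable D2).
Hypotheses (mX1 : measurable_fun D1 X1) (mX2 : measurable_fun D2 X2).
Hypotheses (mW1 : measurable_fun D1 W1) (mW2 : measurable_fun D2 W2).
Hypotheses (W10 : forall x, D1 x -> 0 <= W1 x) (W20 : forall x, D2 x -> 0 <= W2 x).
Hypothesis eq_indic : forall B : set (measurableTypeR R), measurable B ->
  (\int[mu1]_(x in D1) (\1_B (X1 x) * W1 x)%:E = \int[mu2]_(x in D2)
    (\1_B (X2 x) * W2 x)%:E)%E.

(** From indicators to simple functions by linearity, then to nonnegative functions by monotone
    convergence. The weights carry the density on one side and the remaining coordinates on the
    other. *)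
Lemma integral_transfer (h : measurableTypeR R -> R) : measurable_fun setT h ->
  (forall x, 0 <= h x) ->
  (\int[mu1]_(x in D1) (h (X1 x) * W1 x)%:E = \int[mu2]_(x in D2) (h (X2 x) * W2 x)%:E)%E.
Proof.
move=> mh h0; have {}mh : measurable_fun setT (EFin \o h) by exact/measurable_EFinP.
have c1 := @cvg_integral_weighted _ _ _ mu1 _ _ _ mD1 mX1 mW1 W10 _ mh h0.
have c2 := @cvg_integral_weighted _ _ _ mu2 _ _ _ mD2 mX2 mW2 W20 _ mh h0.
rewrite -(cvg_lim _ c1)// -(cvg_lim _ c2)//.
congr (limn _); apply/funext => n.
rewrite !integral_weighted_nnsfun//; apply: eq_fsbigr => r _.
by rewrite eq_indic.
Qed.

End IntegralTransfer.

(* The joint law is only given on rectangles; replacing the indicators by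
   arbitrary nonnegative functions one coordinate at a time avoids building the
   product measure. *)
Section ProductLaw.
Context {R : realType} {d : measure_display} {Omega : measurableType d}.
Variables (P : {measure set Omega -> \bar R}) (D : set Omega).
Hypothesis mD : measurable D.
Variables (I : choiceType) (s : seq I) (X : I -> Omega -> R).
Hypothesis s_uniq : uniq s.
Hypothesis mX : forall e, measurable_fun setT (X e).
Variables (mu : {measure set (measurableTypeR R) -> \bar R})
  (A : set (measurableTypeR R)).
Variables (phi : I -> R -> R) (c : R).
Hypothesis mA : measurable A.
Hypothesis mphi : forall e, measurable_fun A (phi e).
Hypothesis phi_ge0 : forall e x, A x -> 0 <= phi e x.
Hypothesis phi1 : forall e, (\int[mu]_(x in A) (phi e x)%:E = 1)%E.
Hypothesis c0 : 0 <= c.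
Hypothesis rect : forall B : I -> set (measurableTypeR R),
  (forall e, measurable (B e)) ->
  (P (D `&` [set w | forall e, e \in s -> B e (X e w)]) =
   (c * \prod_(e <- s) fine (\int[mu]_(x in A `&` B e) (phi e x)%:E))%:E)%E.

Lemma integral_prod_law (h : I -> measurableTypeR R -> R) :
  (forall e, measurable_fun setT (h e)) -> (forall e x, 0 <= h e x) ->
  (forall e, \int[mu]_(x in A) (h e x * phi e x)%:E < +oo)%E ->
  (\int[P]_(w in D) (\prod_(e <- s) h e (X e w))%:E =
   (c * \prod_(e <- s) fine (\int[mu]_(x in A) (h e x * phi e x)%:E))%:E)%E.
Proof.
move: h; have fin_ind e B : measurable B -> (\int[mu]_(x in A)
  (\1_B x * phi e x)%:E < +oo)%E.
  move=> mB; apply: (@le_lt_trans _ _ 1%E); last exact: ltry.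
  rewrite -(phi1 e); apply: ge0_le_integral => //.
  - by move=> x Ax; rewrite lee_fin mulr_ge0 ?phi_ge0.
  - by apply/measurable_EFinP; apply: measurable_funM => //; exact: measurable_indic.
  - by apply/measurable_EFinP; exact: mphi.
  - by move=> x Ax; rewrite lee_fin ler_piMl ?phi_ge0// indicE; case: (x \in B).
(* Induction on the list [r] of coordinates already freed; the others still carry indicators. The
   empty list is the hypothesis on rectangles. *)
suff main (r : seq I) (h : I -> measurableTypeR R -> R) :
  (forall e, measurable_fun setT (h e)) -> (forall e x, 0 <= h e x) ->
  (forall e, \int[mu]_(x in A) (h e x * phi e x)%:E < +oo)%E ->
  (forall e, e \notin r -> exists2 B, measurable B & h e = \1_B) ->
  (\int[P]_(w in D) (\prod_(e <- s) h e (X e w))%:E =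
   (c * \prod_(e <- s) fine (\int[mu]_(x in A) (h e x * phi e x)%:E))%:E)%E.
  move=> h mh h0 hfin.
  rewrite (_ : (\int[P]_(w in D) (\prod_(e <- s) h e (X e w))%:E)%E =
    (\int[P]_(w in D) (\prod_(e <- s) (fun e => if e \in s then h e else \1_setT)
      e (X e w))%:E)%E); last first.
    by apply: eq_integral => w _; congr (_%:E); apply: eq_big_seq => e ->.
  rewrite (main s (fun e => if e \in s then h e else \1_setT)).
  - by congr (_%:E); congr (_ * _); apply: eq_big_seq => e ->.
  - by move=> e; case: ifP => // _; exact: measurable_indic.
  - by move=> e x; case: ifP.
  - by move=> e; case: ifP => // _; exact: fin_ind.
  - by move=> e /negbTE ->; exists setT.
elim: r h => [|e0 r IH] h mh h0 hfin hB.
  have {}hB e : {B | measurable B & h e = \1_B}.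
    by apply: cid2; exact: hB.
  pose B e := s2val (hB e).
  have mB e : measurable (B e) by rewrite /B; case: (hB e).
  have hE e : h e = \1_(B e) by rewrite /B; case: (hB e).
  pose H := [set w | forall e, e \in s -> B e (X e w)].
  have mH : measurable H.
    rewrite (_ : H = \bigcap_(e in [set` s]) (X e @^-1` B e)); last by apply/seteqP;
      split=> w Hw e; exact: Hw.
    apply: fin_bigcap_measurable => [|e _]; first exact: finite_seq.
    rewrite -[X in measurable X]setTI; exact: (@mX e measurableT (B e) (mB e)).
  transitivity (\int[P]_(w in D) (\1_H w)%:E)%E.
    apply: eq_integral => w _; congr (_%:E); rewrite indicE.
    have [|] := boolP (w \in H); rewrite ?notin_setE ?in_setE/= => Hw.
      by rewrite big_seq big1// => e es; rewrite hE indicE mem_set//; exact: Hw.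
    have [e /not_implyP[es nB]] := (existsNP _).2 Hw.
    by rewrite (big_rem e)//= hE indicE memNset// mul0r.
  rewrite integral_indic// setIC rect//; congr (_%:E); congr (_ * _).
  apply: eq_bigr => e _; congr fine; rewrite integral_mkcondr; apply: eq_integral => x _.
  by rewrite hE patchE indicE; case: (x \in B e); rewrite ?mul1r ?mul0r.
have fine_ge0 e : 0 <= fine (\int[mu]_(x in A) (h e x * phi e x)%:E)%E.
  by apply: fine_ge0; apply: integral_ge0 => x Ax; rewrite lee_fin mulr_ge0 ?h0 ?phi_ge0.
have IHB (B : set (measurableTypeR R)) : measurable B ->
    let h' e := if e == e0 then \1_B else h e in
    (\int[P]_(w in D) (\prod_(e <- s) h' e (X e w))%:E =
     (c * \prod_(e <- s) fine (\int[mu]_(x in A) (h' e x * phi e x)%:E))%:E)%E.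
  move=> mB h'; apply: IH.
  - by move=> e; rewrite /h'; case: ifP => // _; exact: measurable_indic.
  - by move=> e x; rewrite /h'; case: ifP.
  - by move=> e; rewrite /h'; case: ifP => // _; exact: fin_ind.
  - move=> e er; rewrite /h'; case: ifPn => ee0; first by exists B.
    by apply: hB; rewrite inE negb_or ee0.
have [e0s|e0s] := boolP (e0 \in s); last first.
  have h's e : e \in s -> (if e == e0 then \1_setT else h e) = h e.
    by move=> es; case: ifP => // /eqP ee0; move: e0s; rewrite -ee0 es.
  have /= := IHB setT measurableT; rewrite (eq_big_seq
    (fun e => fine (\int[mu]_(x in A) (h e x * phi e x)%:E)%E)).
    move=> <-; apply: eq_integral => w _; congr (_%:E); apply: eq_big_seq => e es.
    by rewrite h's.
  by move=> e es; rewrite h's.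
(* The contribution of the other coordinates: weighted by [W1], the law of [X e0] has density
   [K * phi e0] on [A]. *)
pose K := c * \prod_(e <- rem e0 s) fine (\int[mu]_(x in A) (h e x * phi e x)%:E)%E.
have K0 : 0 <= K by rewrite mulr_ge0// prodr_ge0.
pose W1 w := \prod_(e <- rem e0 s) h e (X e w).
have mW1 : measurable_fun D W1.
  apply: measurable_prod => e _; apply: measurable_funTS.
  exact: (measurableT_comp (mh e) (mX e)).
have rem_ne e : e \in rem e0 s -> (e == e0) = false.
  by move=> er; apply/negbTE; apply: contraTneq er => ->; rewrite mem_rem_uniqF.
have transfer : forall B : set (measurableTypeR R), measurable B ->
    (\int[P]_(w in D) (\1_B (X e0 w) * W1 w)%:E = \int[mu]_(x in A)
      (\1_B x * (K * phi e0 x))%:E)%E.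
  move=> B mB; have /= := IHB B mB; rewrite (big_rem e0)//= eqxx.
  rewrite (eq_big_seq (fun e => fine (\int[mu]_(x in A) (h e x * phi e x)%:E)%E));
    last first.
    by move=> e er; rewrite rem_ne.
  move=> E; transitivity (K%:E * \int[mu]_(x in A) (\1_B x * phi e0 x)%:E)%E.
    transitivity (\int[P]_(w in D)
      (\prod_(e <- s) (if e == e0 then \1_B else h e) (X e w))%:E)%E.
      apply: eq_integral => w _; congr (_%:E); rewrite (big_rem e0)//= eqxx;
        congr (_ * _).
      by apply: eq_big_seq => e er; rewrite rem_ne.
    rewrite E mulrCA [X in X%:E]mulrC EFinM -/K fineK// ge0_fin_numE ?fin_ind//.
    by apply: integral_ge0 => x Ax; rewrite lee_fin mulr_ge0 ?phi_ge0.
  rewrite -ge0_integralZl_EFin//.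
  - by apply: eq_integral => x _; rewrite -EFinM; congr (_%:E); ring.
  - by move=> x Ax; rewrite lee_fin mulr_ge0 ?phi_ge0.
  - by apply/measurable_EFinP; apply: measurable_funM => //; exact: measurable_indic.
have /= := @integral_transfer _ _ _ _ _ P mu D A (X e0) W1 id (fun x => K * phi e0 x)
  mD mA _ _ mW1 _ _ _ transfer (h e0) (mh e0) (h0 e0).
move=> /(_ _ _ _ _ _) E.
transitivity (\int[P]_(w in D) (h e0 (X e0 w) * W1 w)%:E)%E.
  by apply: eq_integral => w _; rewrite (big_rem e0).
rewrite E.
- rewrite (big_rem e0)//= mulrCA [X in X%:E]mulrC EFinM -/K fineK; last first.
    rewrite ge0_fin_numE ?hfin//.
    by apply: integral_ge0 => x Ax; rewrite lee_fin mulr_ge0 ?h0 ?phi_ge0.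
  rewrite -ge0_integralZl_EFin//.
  - by apply: eq_integral => x _; rewrite -EFinM; congr (_%:E); ring.
  - by move=> x Ax; rewrite lee_fin mulr_ge0 ?h0 ?phi_ge0.
  - by apply/measurable_EFinP; apply: measurable_funM => //; exact: measurable_funTS.
- exact: measurable_funTS.
- exact: measurable_id.
- by apply: measurable_funM.
- by move=> w _; apply: prodr_ge0.
- by move=> x Ax; rewrite mulr_ge0 ?phi_ge0.
Qed.

Let DA := D `&` [set w | forall e, e \in s -> A (X e w)].

Lemma measurable_prod_domain : measurable DA.
Proof.
apply: measurableI => //.
rewrite (_ : [set w | _] = \bigcap_(e in [set` s]) (X e @^-1` A)); last first.
  by apply/seteqP; split=> w Hw e; exact: Hw.
apply: fin_bigcap_measurable => [|e _]; first exact: finite_seq.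
by rewrite -[X in measurable X]setTI; exact: (@mX e measurableT A mA).
Qed.

Lemma measure_prod_domain : P DA = c%:E.
Proof.
rewrite /DA (rect (fun=> mA)); congr (_%:E).
rewrite big1 ?mulr1// => e _; rewrite setIid.
by rewrite phi1.
Qed.

Variables (g : I -> R -> R) (v : R).
Hypothesis mg : forall e, measurable_fun A (g e).
Hypothesis mgf : forall e l,
  (\int[mu]_(x in A) (expR (l * g e x) * phi e x)%:E <= (expR (v * l ^+ 2))%:E)%E.

(** Extension by zero, measurable on the whole line; it agrees with [g e] for outcomes in [A]. *)
Let gA e : measurableTypeR R -> R := g e \_ A.

Let mgA e : measurable_fun setT (gA e).
Proof. by rewrite /gA; exact: (proj1 (measurable_restrictT
  (g e : measurableTypeR R -> R) mA) (mg e)). Qed.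

Definition linear_score (sigma : I -> R) (w : Omega) : R :=
  \sum_(e <- s) sigma e * gA e (X e w).

Lemma measurable_linear_score sigma : measurable_fun setT (linear_score sigma).
Proof.
apply: measurable_sum => e; apply: measurable_funM => //.
exact: (measurableT_comp (mgA e) (mX e)).
Qed.

Lemma measurable_score_ge sigma a : measurable [set w | a <= linear_score sigma w].
Proof.
rewrite -[X in measurable X]setTI.
exact: (measurable_fun_le measurableT (measurable_cst a) (measurable_linear_score sigma)).
Qed.

(** Exponential Markov inequality. The indicator of [A] inside [h] restricts to [DA] and leaves a
    product of one-coordinate functions, to which the product law applies. *)
Lemma linear_score_tail sigma a l : 0 <= l ->
  (P (DA `&` [set w | (a <= linear_score sigma w)%R]) <=
   (c * expR (v * l ^+ 2 * \sum_(e <- s) sigma e ^+ 2 - l * a))%:E)%E.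
Proof.
move=> l0.
pose h e : measurableTypeR R -> R := fun x => \1_A x * expR (l * sigma e * gA e x).
have mh e : measurable_fun setT (h e).
  apply: measurable_funM; first exact: measurable_indic.
  by apply: measurableT_comp => //; apply: measurable_funM.
have h0 e x : 0 <= h e x by rewrite mulr_ge0// expR_ge0.
have hE e : (\int[mu]_(x in A) (h e x * phi e x)%:E =
    \int[mu]_(x in A) (expR (l * sigma e * g e x) * phi e x)%:E)%E.
  by apply: eq_integral => x xA; rewrite /h indicE xA mul1r /gA patchE xA.
have hfin e : (\int[mu]_(x in A) (h e x * phi e x)%:E < +oo)%E.
  by rewrite hE; apply: le_lt_trans (mgf _ _) _; exact: ltry.
have E := integral_prod_law mh h0 hfin.
set F := DA `&` _.
have mF : measurable F.
  apply: measurableI; first exact: measurable_prod_domain.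
  exact: measurable_score_ge.
have -> : F = F `&` D by apply/esym/setIidPl => w [[]].
rewrite -integral_indic//.
apply: (@le_trans _ _ (\int[P]_(w in D) ((expR (- (l * a)))%:E *
  (\prod_(e <- s) h e (X e w))%:E))%E).
  apply: ge0_le_integral => //.
  - by apply/measurable_EFinP; exact: measurable_indic.
  - apply/measurable_EFinP; apply: measurable_funM => //; apply: measurable_prod => e _.
    by apply: measurable_funTS; exact: (measurableT_comp (mh e) (mX e)).
  move=> w _; rewrite -EFinM lee_fin indicE.
  have [|_] := boolP (w \in F); last by rewrite mulr_ge0 ?expR_ge0// prodr_ge0.
  rewrite in_setE => -[[_ wA] wa].
  rewrite (eq_big_seq (fun e => expR (l * (sigma e * gA e (X e w))))); last first.
    by move=> e es; rewrite /h indicE mem_set ?mul1r -?mulrA//; exact: wA.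
  rewrite -expR_sum -mulr_sumr -expRD -expR0 ler_expR.
  by have := ler_wpM2l l0 wa; rewrite /linear_score; lra.
rewrite ge0_integralZl_EFin ?expR_ge0//; last 2 first.
- by move=> w _; rewrite lee_fin prodr_ge0.
- apply/measurable_EFinP; apply: measurable_prod => e _.
  by apply: measurable_funTS; exact: (measurableT_comp (mh e) (mX e)).
rewrite E -EFinM lee_fin mulrCA; apply: ler_wpM2l => //.
rewrite expRD mulrC; apply: ler_wpM2r; first exact: expR_ge0.
rewrite mulr_sumr expR_sum; apply: ler_prod => e _; apply/andP; split.
  by apply: fine_ge0; apply: integral_ge0 => x Ax; rewrite lee_fin mulr_ge0 ?phi_ge0.
rewrite -lee_fin fineK.
  by rewrite hE; apply: le_trans (mgf _ _) _; rewrite exprMn mulrA.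
rewrite ge0_fin_numE ?hfin//.
by apply: integral_ge0 => x Ax; rewrite lee_fin mulr_ge0 ?phi_ge0.
Qed.

Lemma linear_score_chernoff sigma a : 0 <= a -> 0 < v * \sum_(e <- s) sigma e ^+ 2 ->
  (P (DA `&` [set w | (a <= linear_score sigma w)%R]) <=
   (c * expR (- (a ^+ 2 / (4 * (v * \sum_(e <- s) sigma e ^+ 2)))))%:E)%E.
Proof.
move=> a0; set V := \sum_(e <- s) _ => vV0.
(* The minimizer of [v * V * l ^+ 2 - l * a]. *)
have l0 : 0 <= a / (2 * (v * V)) by rewrite divr_ge0// mulr_ge0// ltW.
have := linear_score_tail sigma a l0.
rewrite -/V; suff -> : v * (a / (2 * (v * V))) ^+ 2 * V - a / (2 * (v * V)) * a =
  - (a ^+ 2 / (4 * (v * V))) by [].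
have : v * V != 0 by rewrite gt_eqF.
by rewrite mulf_eq0 negb_or => /andP[v0 V0]; field; rewrite v0 V0.
Qed.

(** A union bound scaled by [c], the probability of [D]; this is the conditional bound given [D],
    without dividing by a probability that may be 0. *)
Lemma linear_score_union (J : finType) (Q : pred J) (sigma : J -> I -> R)
  (a eps : J -> R) :
  (forall j, Q j -> 0 <= a j) -> (forall j, Q j -> 0 < v * \sum_(e <- s) sigma j e ^+ 2)
    ->
  (forall j, Q j -> expR (- (a j ^+ 2 / (4 * (v * \sum_(e <- s) sigma j e ^+ 2)))) <=
    eps j) ->
  exists F, [/\ measurable F,
    F `<=` [set w | D w /\ (forall e, e \in s -> A (X e w)) /\
              forall j, Q j -> linear_score (sigma j) w < a j] &
    ((c * (1 - \sum_(j | Q j) eps j))%:E <= P F)%E].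
Proof.
move=> a0 V0 ae.
pose B j := [set w | (a j <= linear_score (sigma j) w)%R].
have mB j : measurable (B j) by exact: measurable_score_ge.
pose U := \big[setU/set0]_(j | Q j) B j.
have mU : measurable U by apply: bigsetU_measurable => j _.
have PU : (P (DA `&` U) <= (c * \sum_(j | Q j) eps j)%:E)%E.
  rewrite mulr_sumr -sumEFin.
  apply: (@le_trans _ _ (\sum_(j | Q j) P (DA `&` B j))%E).
    rewrite /U; elim: (index_enum J) => [|j r IHr];
      first by rewrite !big_nil setI0 measure0.
    rewrite !big_cons; case: ifP => // _; rewrite setIUr; apply:
      le_trans (measureU2 _ _ _) _.
    - by apply: measurableI => //; exact: measurable_prod_domain.
    - apply: measurableI; first exact: measurable_prod_domain.
      by apply: bigsetU_measurable.
    by rewrite leeD2l.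
  apply: lee_sum => j Qj; apply: le_trans (linear_score_chernoff (a0 j Qj) (V0 j Qj)) _.
  by rewrite lee_fin ler_wpM2l// ae.
exists (DA `\` U); split.
- by apply: measurableD => //; exact: measurable_prod_domain.
- move=> w [[Dw Aw] nU]; split=> //; split=> // j Qj; rewrite ltNge; apply/negP => aj.
  by apply: nU; rewrite /U -bigcup_seq_cond; exists j => //=; rewrite mem_index_enum.
have E : (c%:E = P (DA `\` U) + P (DA `&` U))%E.
  by rewrite -measure_prod_domain; exact: measureDI measurable_prod_domain mU.
move: PU; set q := P (DA `&` U) in E *; move: E; case: q => [q||] E PU //.
  rewrite lee_fin in PU; move: E; case: (P _) => [r||]//= [E].
  by rewrite lee_fin; lra.
by move: E; case: (P _).
Qed.

End ProductLaw.

(** * Comparison counts *)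

Section SubsetSums.
Context {R : realType} (n : nat).

Lemma sum_subsets_expr (x : R) : \sum_(S : {set 'I_n}) x ^+ #|S| = (1 + x) ^+ n.
Proof.
transitivity (\prod_(i < n) (x + 1)); last by rewrite prodr_const card_ord addrC.
rewrite bigA_distr; apply: eq_bigr => S _.
by rewrite -big_mkcond prodr_const.
Qed.

(** The sum is [(1 + x) ^+ n - 1 <= expR (n * x) - 1]. It bounds the failure over all vertex sets at
    once when [S] fails with probability at most [x ^+ #|S|]. *)
Lemma sum_nonempty_subsets_expr (x : R) : 0 <= x -> n%:R * x <= 1 / 2 ->
  \sum_(S : {set 'I_n} | (0 < #|S|)%N) x ^+ #|S| <= 2 * (n%:R * x).
Proof.
move=> x0 nx1; rewrite (eq_bigl (fun S : {set 'I_n} => S != finset.set0)) => [|S];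
  last first.
  by rewrite card_gt0.
have := sum_subsets_expr x.
rewrite (bigD1 finset.set0)//= cards0 expr0.
move=> E; have h1 : (1 + x) ^+ n <= expR (n%:R * x).
  by rewrite expRM_natl; apply: lerXn2r; rewrite ?nnegrE ?addr_ge0 ?expR_ge0 ?expR_ge1Dx.
have nx0 : 0 <= n%:R * x by rewrite mulr_ge0.
set y := n%:R * x in nx1 h1 nx0 *.
have h2 : expR y <= 1 + 2 * y.
  rewrite -[leLHS]invrK -expRN invf_ple ?posrE ?expR_gt0//; last lra.
  apply: le_trans (expR_ge1Dx _).
  rewrite -[leLHS]mul1r ler_pdivrMr; last lra.
  by have := mulr_ge0 nx0 (_ : 0 <= 1 - 2 * y); rewrite subr_ge0 => /(_ ltac:(lra)); lra.
lra.
Qed.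

End SubsetSums.

(** * Binomial counts: expansion of all cuts and bounded degrees *)

Section BinomialCounts.
Context {R : realType} (n T : nat) (p : 'I_n -> 'I_n -> R).
Hypothesis p01 : forall i j, i != j -> 0 < p i j <= 1.
Notation edge := ('I_n * 'I_n)%type.
Notation config := {ffun edge -> 'I_T.+1}.

Definition is_edge (e : edge) : bool := (e.1 < e.2)%N.

(** Pairs that are not edges get a unit mass at 0, so that the law of the counts is a product over
    all pairs. *)
Definition edge_pmf (e : edge) (a : nat) : R :=
  if is_edge e then binomial_pmf T (p e.1 e.2) a else (a == 0%N)%:R.

Definition config_weight (m : config) : R := \prod_e edge_pmf e (m e).

Lemma edge_neq (e : edge) : is_edge e -> e.1 != e.2.
Proof. by rewrite /is_edge => /ltn_eqF/negbT. Qed.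

Lemma edge_pmf_ge0 e a : 0 <= edge_pmf e a.
Proof.
rewrite /edge_pmf; case: ifP => // /edge_neq/p01/andP[p0 p1].
by rewrite binomial_pmf_ge0// ltW.
Qed.

Lemma config_weight_ge0 m : 0 <= config_weight m.
Proof. by apply: prodr_ge0 => e _; exact: edge_pmf_ge0. Qed.

Lemma binomial_mgf (q l : R) :
  \sum_(a < T.+1) binomial_pmf T q a * expR (l * a%:R) = (1 + q * (expR l - 1)) ^+ T.
Proof.
have -> : 1 + q * (expR l - 1) = (1 - q) + q * expR l by ring.
rewrite exprDn; apply: eq_bigr => a _.
by rewrite /binomial_pmf mulrnAl expRM_natr exprMn; congr (_ *+ _); ring.
Qed.

(** Each binomial factor [(1 + p * (expR l - 1)) ^+ T] is at most its Poisson counterpart. *)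
Lemma config_mgf (l : edge -> R) :
  \sum_(m : config) config_weight m * expR (\sum_(e | is_edge e) l e * (m e)%:R) <=
  expR (\sum_(e | is_edge e) T%:R * p e.1 e.2 * (expR (l e) - 1)).
Proof.
pose l' e := if is_edge e then l e else 0.
rewrite (eq_bigr (fun m : config => \prod_e (edge_pmf e (m e)
  * expR (l' e * (m e)%:R)))); last first.
  move=> m _; rewrite big_split/=; congr (_ * _).
  rewrite expR_sum big_mkcond; apply: eq_bigr => e _; rewrite /l'.
  by case: ifP; rewrite ?mul0r ?expR0.
rewrite -(bigA_distr_bigA (fun e (a : 'I_T.+1) => edge_pmf e a * expR (l' e * a%:R))).
rewrite expR_sum [leRHS]big_mkcond/=; apply: ler_prod => e _; apply/andP; split.
  by apply: sumr_ge0 => a _; rewrite mulr_ge0 ?edge_pmf_ge0 ?expR_ge0.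
rewrite /edge_pmf /l'; case: ifP => [/edge_neq/p01/andP[p0 p1]|_].
  rewrite binomial_mgf -mulrA expRM_natl; apply: lerXn2r;
    rewrite ?nnegrE ?expR_ge0 ?expR_ge1Dx//.
  have := expR_ge0 (l e); have : p e.1 e.2 * expR (l e) >=
    0 by rewrite mulr_ge0 ?expR_ge0// ltW.
  lra.
rewrite big_ord_recl/= mul0r expR0 mulr1 big1 ?addr0// => a _.
by rewrite mul0r.
Qed.

Lemma config_weight_sum : \sum_(m : config) config_weight m = 1.
Proof.
rewrite /config_weight -(bigA_distr_bigA (fun e (a : 'I_T.+1) => edge_pmf e a))
  big1// => e _.
rewrite /edge_pmf; case: (is_edge e).
  have := binomial_mgf (p e.1 e.2) 0; rewrite expR0 subrr mulr0 addr0 expr1n => <-.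
  by apply: eq_bigr => a _; rewrite mul0r expR0 mulr1.
by rewrite big_ord_recl/= big1 ?addr0.
Qed.

Lemma config_chernoff (l : edge -> R) (a : R) (Q : pred config) :
  (forall m, Q m -> a <= \sum_(e | is_edge e) l e * (m e)%:R) ->
  \sum_(m | Q m) config_weight m <=
  expR (\sum_(e | is_edge e) T%:R * p e.1 e.2 * (expR (l e) - 1) - a).
Proof.
move=> Qa; rewrite expRD mulrC.
apply: le_trans (ler_wpM2l (expR_ge0 _) (config_mgf l)).
rewrite mulr_sumr [leLHS]big_mkcond; apply: ler_sum => m _; case: ifP => [/Qa am|_].
  rewrite mulrCA -expRD -[leLHS]mulr1 ler_wpM2l ?config_weight_ge0// -[leLHS]expR0
    ler_expR; lra.
by rewrite !mulr_ge0 ?expR_ge0 ?config_weight_ge0.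
Qed.

Definition edge_weight (m : config) (i j : 'I_n) : R :=
  if (i < j)%N then (m (i, j))%:R else if (j < i)%N then (m (j, i))%:R else 0.

Lemma edge_weight_sym m i j : edge_weight m i j = edge_weight m j i.
Proof. by rewrite /edge_weight; case: ltngtP. Qed.

Lemma edge_weight_ge0 m i j : 0 <= edge_weight m i j.
Proof. by rewrite /edge_weight; case: ltngtP. Qed.

Lemma sum_edges (F : 'I_n -> 'I_n -> R) : (forall i j, F i j = F j i) ->
  (forall i, F i i = 0) ->
  \sum_i \sum_j F i j = 2 * \sum_(e | is_edge e) F e.1 e.2.
Proof.
move=> Fsym F0; rewrite pair_bigA/= (bigID is_edge)/=
  [X in _ + X = _](_ : _ = \sum_(e | is_edge e) F e.1 e.2); first by ring.
rewrite (bigID (fun e : edge => e.1 == e.2))/= big1 ?add0r => [|e /andP[_ /eqP->]];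
  last exact: F0.
rewrite (reindex_inj (h := fun e : edge => (e.2, e.1))) => [|[a b] [a' b'] [-> ->]//].
apply: eq_big => [e|e _]; last by rewrite Fsym.
by rewrite /is_edge/= -leqNgt [RHS]ltn_neqAle andbC eq_sym.
Qed.

Lemma cut_edges (F : 'I_n -> 'I_n -> R) (S : {set 'I_n}) : (forall i j, F i j = F j i) ->
  cut F S = \sum_(e | is_edge e) ((e.1 \in S) (+) (e.2 \in S))%:R * F e.1 e.2.
Proof.
move=> Fsym; pose G i j := ((i \in S) (+) (j \in S))%:R * F i j.
have : \sum_i \sum_j G i j = 2 * cut F S.
  have -> : 2 * cut F S = cut F S + cut F S by ring.
  rewrite {1}cut_indicE cut_indicE [X in _ = _ + X]exchange_big/=.
  rewrite -big_split; apply: eq_bigr => i _; rewrite -big_split; apply: eq_bigr => j _.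
  by rewrite /G [F j i]Fsym; case: (i \in S); case: (j \in S) => /=; ring.
rewrite (sum_edges (F := G)) => [|i j|i]; [lra|by rewrite /G addbC Fsym|by rewrite /G
  addbb mul0r].
Qed.

Lemma edge_weightE m (e : edge) : is_edge e -> edge_weight m e.1 e.2 = (m e)%:R.
Proof. by rewrite /edge_weight /is_edge; case: e => a b /= ->. Qed.

Variables (pmin pmax : R).
Hypothesis pmin_le : forall i j, i != j -> pmin <= p i j.
Hypothesis le_pmax : forall i j, i != j -> p i j <= pmax.
Hypothesis pmin_gt0 : 0 < pmin.
Hypothesis pmax_ge0 : 0 <= pmax.

(** Chernoff bound with exponent -1 on boundary edges, using [expR (-1) - 1 <= - 1 / 2]. There are
    at least [n * #|S| / 2] boundary pairs, so with [X = T * n * pmin * #|S|] the exponent is at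
    most [- X / 4 + X / 8]. *)
Lemma cut_lower_tail (S : {set 'I_n}) : (2 * #|S| <= n)%N ->
  \sum_(m : config | cut (edge_weight m) S < T%:R * n%:R * pmin / 8 * #|S|%:R)
    config_weight m
   <= expR (- (T%:R * n%:R * pmin / 8)) ^+ #|S|.
Proof.
move=> S2; pose bd (e : edge) : R := ((e.1 \in S) (+) (e.2 \in S))%:R.
set b := T%:R * n%:R * pmin / 8.
apply: (@le_trans _ _ (expR (\sum_(e | is_edge e) T%:R * p e.1 e.2 * (expR (- bd e) - 1)
  - - (b * #|S|%:R)))).
  apply: config_chernoff => m lt; rewrite -lerN2 opprK; apply: le_trans (ltW lt).
  rewrite -sumrN cut_edges => [|i j]; last exact: edge_weight_sym.
  apply: le_of_eq; apply: eq_bigr => e ee.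
  by rewrite edge_weightE// mulNr opprK.
rewrite -expRM_natr ler_expR.
have h : \sum_(e | is_edge e) T%:R * p e.1 e.2 * (expR (- bd e) - 1) <=
    - (T%:R * pmin / 2) * cut (fun _ _ => 1) S.
  rewrite cut_edges// mulr_sumr; apply: ler_sum => e ee.
  have ne := edge_neq ee; have := pmin_le ne => hp.
  have pp : 0 < p e.1 e.2 by exact: lt_le_trans hp.
  rewrite mulr1 /bd; case: (_ (+) _) => /=; last by rewrite oppr0 expR0 subrr !mulr0.
  have e1 : expR (- 1 : R) <= 1 / 2.
    rewrite expRN -[1/2]mul1r -[X in _ <= X]mul1r; rewrite -div1r ler_pdivrMr ?expR_gt0//.
    by have := expR_ge1Dx (1 : R); lra.
  have Tp : T%:R * pmin <= T%:R * p e.1 e.2 by rewrite ler_wpM2l.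
  have Tp0 : 0 <= T%:R * p e.1 e.2 by rewrite mulr_ge0// ltW.
  have := ler_wpM2l Tp0 (_ : expR (-1) - 1 <= - (1/2)).
  move=> /(_ ltac:(lra)); lra.
have c : n%:R * #|S|%:R <= 2 * cut (fun _ _ => 1 : R) S.
  rewrite /cut; under eq_bigr do rewrite sumr_const.
  rewrite sumr_const -[_ *+ #|S|]mulr_natr.
  have -> : #|~: S|%:R = n%:R - #|S|%:R :> R.
    have := cardsC S; rewrite card_ord => nE; apply/eqP; rewrite -subr_eq opprK.
    by rewrite -natrD addnC nE.
  have : 2 * #|S|%:R <= n%:R :> R by rewrite -natrM ler_nat.
  move=> h2; have := ler_wpM2r (ler0n R #|S|) h2; lra.
have : T%:R * pmin / 4 * (n%:R * #|S|%:R) <= T%:R * pmin / 4 *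
  (2 * cut (fun _ _ => 1 : R) S).
  by apply: ler_wpM2l => //; rewrite !mulr_ge0// ltW.
rewrite /b; lra.
Qed.

(** Chernoff bound with exponent 1/2 on the edges at [j], using [expR (1 / 2) - 1 <= 1]: the
    exponent is at most [D - 2 * D]. *)
Lemma degree_upper_tail (j : 'I_n) :
  \sum_(m : config | 4 * (T%:R * n%:R * pmax) < \sum_i edge_weight m i j) config_weight m
   <= expR (- (T%:R * n%:R * pmax)).
Proof.
set D := T%:R * n%:R * pmax.
pose inc (e : edge) : R := ((e.1 == j) || (e.2 == j))%:R.
have degE (F : 'I_n -> 'I_n -> R) : (forall a b, F a b = F b a) -> (F j j = 0) ->
    \sum_(e | is_edge e) inc e * F e.1 e.2 = \sum_i F i j.
  move=> Fsym F0.
  pose G a b := ((a == j) || (b == j))%:R * F a b - (a == b)%:R *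
    ((a == j) || (b == j))%:R * F a b.
  have G0 i : G i i = 0 by rewrite /G eqxx mul1r subrr.
  have Gs a b : G a b = G b a by rewrite /G orbC Fsym [a == b]eq_sym.
  have := sum_edges Gs G0.
  have -> : \sum_(e | is_edge e) G e.1 e.2 = \sum_(e | is_edge e) inc e * F e.1 e.2.
    by apply: eq_bigr => e /edge_neq/negbTE ne; rewrite /G ne mul0r mul0r subr0.
  move=> E; suff : \sum_i \sum_b G i b = 2 * \sum_i F i j by rewrite E; lra.
  rewrite (bigD1 j)//= [X in _ + X](eq_bigr (fun i => F i j)) => [|i ij]; last first.
    rewrite (bigD1 j)//= big1 ?addr0 => [|b bj].
      by rewrite /G eqxx orbT (negbTE ij) mul1r mul0r mul0r subr0.
    by rewrite /G (negbTE ij) (negbTE bj) /=; ring.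
  rewrite [X in X + _](_ : _ = \sum_i F i j); last first.
    rewrite (bigD1 j)//= [RHS](bigD1 j)//= G0 F0; congr (_ + _); apply: eq_bigr => i ij.
    by rewrite /G eqxx /= [j == i]eq_sym (negbTE ij) mul1r mul0r mul0r subr0 Fsym.
  have -> : \sum_(i | i != j) F i j = \sum_i F i j by rewrite [RHS](bigD1 j)//= F0 add0r.
  ring.
apply: (@le_trans _ _ (expR (\sum_(e | is_edge e)
  T%:R * p e.1 e.2 * (expR (inc e / 2) - 1) - 2 * D))).
  apply: config_chernoff => m lt.
  have : (4 * D) / 2 <= (\sum_i edge_weight m i j) / 2 by rewrite ler_wpM2r// ltW.
  rewrite -degE; last 2 first.
  - exact: edge_weight_sym.
  - by rewrite /edge_weight ltnn.
  rewrite mulr_suml => h; apply: (@le_trans _ _ (4 * D / 2)); first lra.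
  apply: le_trans h _; apply: le_of_eq; apply: eq_bigr => e ee.
  by rewrite edge_weightE//; ring.
rewrite ler_expR.
suff : \sum_(e | is_edge e) T%:R * p e.1 e.2 * (expR (inc e / 2) - 1) <= D by lra.
have e12 := @expR_half_le2 R.
apply: (@le_trans _ _ (\sum_(e | is_edge e) inc e *
  ((fun a b => (a != b)%:R * (T%:R * pmax)) e.1 e.2))).
  apply: ler_sum => e ee; have ne := edge_neq ee; rewrite ne mul1r.
  rewrite /inc; case: (_ || _) => /=; last by rewrite mul0r expR0 subrr mulr0 mul0r.
  have /andP[p0 _] := p01 ne.
  have Tp : T%:R * p e.1 e.2 <= T%:R * pmax by rewrite ler_wpM2l// le_pmax.
  have Tp0 : 0 <= T%:R * p e.1 e.2 by rewrite mulr_ge0// ltW.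
  have := ler_wpM2l Tp0 (_ : expR (1 / 2) - 1 <= 1); move=> /(_ ltac:(lra)); lra.
rewrite (degE (fun a b => (a != b)%:R * (T%:R * pmax))); last 2 first.
- by move=> a b; rewrite eq_sym.
- by rewrite eqxx mul0r.
apply: (@le_trans _ _ (\sum_(i < n) T%:R * pmax)).
  by apply: ler_sum => i _; case: (i != j); rewrite ?mul1r ?mul0r// mulr_ge0.
by rewrite sumr_const card_ord -[_ *+ n]mulr_natr /D; lra.
Qed.

(** The two thresholds are the [b] and [D] that [oscillation_bound] receives. *)
Definition good_config (m : config) : bool :=
  [forall S : {set 'I_n}, (0 < #|S|)%N && (2 * #|S| <= n)%N ==>
     (T%:R * n%:R * pmin / 8 * #|S|%:R <= cut (edge_weight m) S)] &&
  [forall j, \sum_i edge_weight m i j <= 4 * (T%:R * n%:R * pmax)].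

(** Cuts fail with weight at most [2 * (n * x)], degrees with weight at most [n * x]. *)
Lemma good_config_weight : pmin <= pmax ->
  n%:R * expR (- (T%:R * n%:R * pmin / 8)) <= 1 / 2 ->
  1 - 3 * (n%:R * expR (- (T%:R * n%:R * pmin / 8)))
    <= \sum_(m : config | good_config m) config_weight m.
Proof.
move=> pp nx; set b := T%:R * n%:R * pmin / 8 in nx *; set x := expR (- b) in nx *.
have x0 : 0 <= x by exact: expR_ge0.
suff : \sum_(m : config | ~~ good_config m) config_weight m <= 3 * (n%:R * x).
  have := config_weight_sum; rewrite (bigID good_config)/=; lra.
pose Q (S : {set 'I_n}) := (0 < #|S|)%N && (2 * #|S| <= n)%N.
apply: (@le_trans _ _
  (\sum_(S | Q S) \sum_(m : config | cut (edge_weight m) S < b * #|S|%:R)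
    config_weight m +
   \sum_j \sum_(m : config | 4 * (T%:R * n%:R * pmax) < \sum_i edge_weight m i j)
     config_weight m)).
  rewrite [X in _ <= X + _](eq_bigr (fun S => \sum_m if cut (edge_weight m)
    S < b * #|S|%:R
      then config_weight m else 0)); last by move=> S _; rewrite big_mkcond.
  rewrite [X in _ <= _ + X](eq_bigr (fun j => \sum_m if 4 * (T%:R * n%:R * pmax)
    < \sum_i edge_weight m i j
      then config_weight m else 0)); last by move=> S _; rewrite big_mkcond.
  rewrite exchange_big [X in _ <= _ + X]exchange_big -big_split/= big_mkcond.
  apply: ler_sum => m _.
  have s1 S : 0 <= (if cut (edge_weight m) S < b * #|S|%:R then config_weight m else 0).
    by case: ifP; rewrite ?config_weight_ge0.
  have s2 j : 0 <= (if 4 * (T%:R * n%:R * pmax)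
    < \sum_i edge_weight m i j then config_weight m else 0).
    by case: ifP; rewrite ?config_weight_ge0.
  case: ifPn => [|_]; last by rewrite addr_ge0// sumr_ge0.
  rewrite negb_and !negb_forall => /orP[/existsP[S]|/existsP[j]].
    rewrite negb_imply -ltNge => /andP[QS lt]; rewrite (bigD1 S)//= lt -addrA lerDl.
    by rewrite addr_ge0// sumr_ge0.
  rewrite -ltNge => lt; rewrite [X in _ + X](bigD1 j)//= lt addrCA lerDl.
  by rewrite addr_ge0// sumr_ge0.
have h1 : \sum_(S | Q S) \sum_(m : config | cut (edge_weight m) S < b * #|S|%:R)
  config_weight m <=
    2 * (n%:R * x).
  apply: le_trans (sum_nonempty_subsets_expr x0 nx).
  rewrite big_mkcond [leRHS]big_mkcond/=; apply: ler_sum => S _; rewrite /Q.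
  case: (0 < #|S|)%N => //=; case: ifP => [S2|_]; last by rewrite exprn_ge0.
  exact: cut_lower_tail.
have h2 : \sum_j \sum_(m : config | 4 * (T%:R * n%:R * pmax) < \sum_i edge_weight m i j)
  config_weight m <= n%:R * x.
  apply: (@le_trans _ _ (\sum_(j < n) x)); last by rewrite sumr_const card_ord
    -[_ *+ n]mulr_natl.
  apply: ler_sum => j _; apply: le_trans (degree_upper_tail j) _.
  rewrite ler_expR lerN2 /b.
  have Tn : 0 <= T%:R * n%:R :> R by rewrite mulr_ge0.
  have := ler_wpM2l Tn pp; have := mulr_ge0 Tn (ltW pmin_gt0); lra.
lra.
Qed.

End BinomialCounts.

Arguments is_edge {n} e.

(** * Regular samples *)

Section Conditioning.
Context {R : realType} (k : domain_kind) (A : set R) (f : R -> R -> R) (T n : nat).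
Context (d : measure_display) (Omega : measurableType d) (P : probability Omega R).
Variables (u : 'rV[R]_n) (p : 'I_n -> 'I_n -> R).
Variables (N : 'I_n -> 'I_n -> {RV P >-> nat}) (X : 'I_n -> 'I_n -> nat -> {RV P >-> R}).
Hypothesis fdom : link_domain k A.
Hypothesis fval : valid_link k A f.
Hypothesis fslc : strictly_log_concave A f.
Hypothesis rates : comparison_rates p.
Hypothesis model : sampling_model k A f T u p N X.
Notation edge := ('I_n * 'I_n)%type.
Notation config := {ffun edge -> 'I_T.+1}.
Notation mu := (base_measure k).

(** [count_event] does not look at [m] off the edges; fixing those values makes the events of
    distinct configurations disjoint. *)
Definition supported (m : config) : bool :=
  [forall e, is_edge e || (m e == ord0)].

Definition count_event (m : config) : set Omega :=
  [set w | forall i j : 'I_n, (i < j)%N -> N i j w = m (i, j)].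

Lemma measurable_count_event m : measurable (count_event m).
Proof.
rewrite (_ : count_event m = \bigcap_(e in [set e | is_edge e])
  (N e.1 e.2 @^-1` [set (m e : nat)])).
  apply: fin_bigcap_measurable => [|e _]; first exact: finite_finset.
  by rewrite -[X in measurable X]setTI; exact: (@measurable_funPT _ _ _ _ (N e.1 e.2)).
apply/seteqP; split=> [w Hw [i j] ij|w Hw i j ij]; first exact: Hw.
exact: (Hw (i, j)).
Qed.

Lemma binomial_prob_set1 (q : R) (a : nat) : 0 <= q <= 1 ->
  binomial_prob T q [set a] = (binomial_pmf T q a)%:E.
Proof.
move=> q01; rewrite /binomial_prob q01 esum_set1// lee_fin.
by rewrite binomial_pmf_ge0//; case/andP: q01.
Qed.

Lemma prod_edges (F : 'I_n -> 'I_n -> R) :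
  \prod_(i < n) \prod_(j < n | (i < j)%N) F i j = \prod_(e | is_edge e) F e.1 e.2.
Proof. by rewrite pair_big_dep. Qed.

Lemma count_event_prob m : supported m -> P (count_event m) = (config_weight p m)%:E.
Proof.
move=> /forallP supp; rewrite (count_independent model
  (fun i j => [set (m (i, j) : nat)])).
congr (_%:E); rewrite prod_edges /config_weight [RHS](bigID is_edge)/=
  [X in _ * X]big1 ?mulr1.
  apply: eq_bigr => e ee; rewrite /edge_pmf ee (count_binomial model _ ee).
  rewrite binomial_prob_set1 /=; first by case: e ee.
  by have [_ /andP[p0 ->]] := rates (edge_neq ee); rewrite ltW.
move=> e /negbTE ne; rewrite /edge_pmf ne; have := supp e; rewrite ne /= => /eqP ->.
by [].
Qed.

Lemma unsupported_weight m : ~~ supported m -> config_weight p m = 0.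
Proof.
rewrite negb_forall => /existsP[e]; rewrite negb_or => /andP[ne me].
rewrite /config_weight (bigD1 e)//= /edge_pmf (negbTE ne)
  (_ : (m e == 0%N :> nat) = false) ?mul0r//.
by apply/negbTE.
Qed.

Notation idx := (edge * 'I_T)%type.

(** One duplicate-free list for the triple index, as the product law expects. *)
Definition outcomes (m : config) : seq idx :=
  [seq x : idx <- enum {: idx} | is_edge x.1 && (x.2 < m x.1)%N].

Lemma mem_outcomes m x : (x \in outcomes m) = is_edge x.1 && (x.2 < m x.1)%N.
Proof. by rewrite mem_filter mem_enum andbT. Qed.

Lemma prod_outcomes m (F : edge -> nat -> R) :
  \prod_(x <- outcomes m) F x.1 x.2 = \prod_(e | is_edge e) \prod_(t < m e) F e t.
Proof.
rewrite /outcomes big_filter big_enum_cond/=.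
rewrite [RHS](eq_bigr (fun e => \prod_(t < T | (t < m e)%N) F e t)) => [|e _]; last first.
  by rewrite (big_ord_widen T (F e))// -ltnS.
by rewrite pair_big_dep.
Qed.

Lemma sum_outcomes m (F : edge -> nat -> R) :
  \sum_(x <- outcomes m) F x.1 x.2 = \sum_(e | is_edge e) \sum_(t < m e) F e t.
Proof.
rewrite /outcomes big_filter big_enum_cond/=.
rewrite [RHS](eq_bigr (fun e => \sum_(t < T | (t < m e)%N) F e t)) => [|e _]; last first.
  by rewrite (big_ord_widen T (F e))// -ltnS.
by rewrite pair_big_dep.
Qed.

Lemma outcome_rectangles m (B : idx -> set (measurableTypeR R)) : supported m ->
  (forall x, measurable (B x)) ->
  P (count_event m `&` [set w | forall x, x \in outcomes m ->
    B x (X x.1.1 x.1.2 x.2 w)]) =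
  (config_weight p m * \prod_(x <- outcomes m)
     fine (\int[mu]_(y in A `&` B x) (f y (u 0 x.1.1 - u 0 x.1.2))%:E))%:E%E.
Proof.
move=> supp mB.
(* The model indexes outcomes by all naturals, [idx] only by those below [T]; the default [setT] is
   never read, as counts are at most [T]. *)
pose B' i j t : set (measurableTypeR R) :=
  if insub t is Some t' then B ((i, j), t') else setT.
have mB' i j t : measurable (B' i j t) by rewrite /B'; case: insub.
have := outcome_conditional_law model (fun i j => m (i, j)) mB'.
rewrite -/(count_event m) count_event_prob// -EFinM.
rewrite (_ : [set w | _] = count_event m `&`
  [set w | forall x, x \in outcomes m -> B x (X x.1.1 x.1.2 x.2 w)]); last first.
  apply/seteqP; split=> w [w1 w2]; split=> //.
    move=> [[i j] t] /=; rewrite mem_outcomes/= => /andP[ij tm].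
    by have := w2 i j t ij tm; rewrite /B' valK.
  move=> i j t ij tm; have tT : (t < T)%N by apply: leq_trans tm _; rewrite -ltnS.
  rewrite /B' insubT; apply: (w2 ((i, j), Ordinal tT)).
  by rewrite mem_outcomes/= tm andbT.
move=> ->; congr (_%:E); congr (_ * _).
pose F (e : edge) (t : nat) := fine (link_law k A f (u 0 e.1 - u 0 e.2) (B' e.1 e.2 t)).
transitivity (\prod_(e | is_edge e) \prod_(t < m e) F e t).
  by rewrite prod_edges; apply: eq_bigr => -[a b].
rewrite -(prod_outcomes m F) /F.
rewrite big_seq [RHS]big_seq; apply: eq_bigr => -[[i j] t] _ /=.
by rewrite /B' valK.
Qed.

Variables (M K : R).
Hypothesis u_range : forall i j, `|u 0 i - u 0 j| <= M.
Hypothesis K_gt0 : 0 < K.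
Hypothesis score_mgf_le : forall y l, `|y| <= M ->
  (\int[mu]_(x in A) (expR (l * glink f x y) * f x y)%:E <=
    (expR (8 * (l * (2 * K)) ^+ 2))%:E)%E.

Definition score_sum (w : Omega) (i j : 'I_n) (y : R) : R :=
  \sum_(t < N i j w) glink f (X i j t w) y.

(** The law places outcomes in [A] only almost surely, while the argument on a fixed sample needs
    all of them there. *)
Definition in_domain (w : Omega) : Prop :=
  forall i j t, i != j -> (t < N i j w)%N -> A (X i j t w).

Lemma score_sum_anti w i j y : in_domain w -> i != j ->
  score_sum w j i (- y) = - score_sum w i j y.
Proof.
move=> Aw ij; rewrite /score_sum (count_sym model w ij) -sumrN; apply: eq_bigr => t _.
have ti : (t < N i j w)%N by rewrite (count_sym model w ij).
by rewrite (outcome_antisym model ij ti) (glink_sym fval fslc)//; exact: Aw.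
Qed.

Lemma count_weight m w i j : count_event m w -> i != j -> (N i j w)%:R =
  edge_weight m i j :> R.
Proof.
move=> mw ij; rewrite /edge_weight; case: ltngtP => [lt|gt|/val_inj E].
- by rewrite mw.
- by rewrite (count_sym model w ij) mw.
- by rewrite E eqxx in ij.
Qed.

Lemma in_domainP m w : count_event m w ->
  (forall x, x \in outcomes m -> A (X x.1.1 x.1.2 x.2 w)) -> in_domain w.
Proof.
move=> mw Ax.
have lt_case (i j : 'I_n) t : (i < j)%N -> (t < N i j w)%N -> A (X i j t w).
  move=> ij; rewrite mw// => tm; have tT : (t < T)%N by apply: leq_trans tm _;
    rewrite -ltnS.
  by apply: (Ax ((i, j), Ordinal tT)); rewrite mem_outcomes/= tm andbT.
move=> i j t ij tN; have := ij; rewrite neq_ltn => /orP[lt|gt]; first exact: lt_case.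
have ji : j != i by rewrite eq_sym.
have tN' : (t < N j i w)%N by rewrite (count_sym model w ji).
rewrite (outcome_antisym model ji tN'); apply: fdom.1; exact: lt_case.
Qed.

Definition boundary_sign (S : {set 'I_n}) (x : idx) : R :=
  (x.1.1 \in S)%:R - (x.1.2 \in S)%:R.

Lemma boundary_sign_sqr m S :
  \sum_(x <- outcomes m) boundary_sign S x ^+ 2 = cut (edge_weight m) S.
Proof.
pose F (e : edge) (t : nat) : R := ((e.1 \in S)%:R - (e.2 \in S)%:R) ^+ 2.
rewrite -[LHS]/(\sum_(x <- outcomes m) F x.1 x.2) sum_outcomes /F cut_edges => [|i j];
  last exact: edge_weight_sym.
apply: eq_bigr => e ee; rewrite edge_weightE// sumr_const card_ord -[_ *+ m e]mulr_natr.
by case: (e.1 \in S); case: (e.2 \in S) => /=; ring.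
Qed.

Notation lscore m := (linear_score (outcomes m) (fun x : idx => X x.1.1 x.1.2 x.2) A
  (fun x y => glink f y (u 0 x.1.1 - u 0 x.1.2))).

(** Antisymmetry turns the score across the boundary into a signed sum over the outcomes with
    [i < j], each taken once, which are independent given the counts. *)
Lemma linear_score_cut m w S : count_event m w -> in_domain w ->
  lscore m (boundary_sign S) w = cut (fun i j => score_sum w i j (u 0 i - u 0 j)) S.
Proof.
move=> mw Aw; pose H i j := score_sum w i j (u 0 i - u 0 j).
have Hanti i j : i != j -> H j i = - H i j.
  by move=> ij; rewrite /H -score_sum_anti// opprB.
have E : lscore m (boundary_sign S) w = \sum_(e | is_edge e)
  ((e.1 \in S)%:R - (e.2 \in S)%:R) * H e.1 e.2.
  pose F (e : edge) (t : nat) := ((e.1 \in S)%:R - (e.2 \in S)%:R) *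
    glink f (X e.1 e.2 t w) (u 0 e.1 - u 0 e.2).
  transitivity (\sum_(x <- outcomes m) F x.1 x.2).
    rewrite /linear_score; apply: eq_big_seq => -[[i j] t].
    rewrite mem_outcomes/= => /andP[ij tm].
    rewrite /F /boundary_sign patchE mem_set//; apply: Aw; first exact:
      (@edge_neq _ (i, j)).
    by rewrite mw.
  rewrite sum_outcomes /F; apply: eq_bigr => e ee; rewrite -mulr_sumr; congr (_ * _).
  by rewrite /H /score_sum (mw _ _ ee); case: (e).
rewrite E; have := antisym_cut S Hanti; rewrite -/H.
pose G i j := if i == j then 0 else H i j * ((i \in S)%:R - (j \in S)%:R).
have -> : \sum_i \sum_(j | i != j) H i j * ((i \in S)%:R - (j \in S)%:R) =
  \sum_i \sum_j G i j.
  apply: eq_bigr => i _; rewrite [LHS]big_mkcond; apply: eq_bigr => j _.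
  by rewrite /G; case: eqP.
rewrite sum_edges => [|i j|i]; last 2 first.
- rewrite /G [j == i]eq_sym; case: eqP => // /eqP ij; rewrite (Hanti _ _ ij); ring.
- by rewrite /G eqxx.
move=> E2; have -> : cut H S = \sum_(e | is_edge e) G e.1 e.2 by lra.
by apply: eq_bigr => e /edge_neq/negbTE ne; rewrite /G ne mulrC.
Qed.

Variables (pmin pmax lam : R).
Hypothesis pmin_gt0 : 0 < pmin.
Hypothesis n_gt0 : (0 < n)%N.
Hypothesis T_gt0 : (0 < T)%N.
Notation kappa := (Num.sqrt (4 * (32 * K ^+ 2) * lam)).
Hypothesis lam_ge0 : 0 <= lam.
Hypothesis lam_small : n%:R * expR (- lam) <= 1 / 4.

(** With the variance proxy [32 * K ^+ 2] and [kappa ^+ 2 = 4 * (32 * K ^+ 2) * lam], a one-sided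
    deviation at the threshold for [S] has Chernoff bound exactly [expR (- lam) ^+ #|S|]. *)
Definition regular_sample (w : Omega) : Prop := exists m : config,
  [/\ good_config pmin pmax m,
      forall i j, i != j -> (N i j w)%:R = edge_weight m i j :> R,
      in_domain w &
      forall S : {set 'I_n}, (0 < #|S|)%N -> (2 * #|S| <= n)%N ->
        `|cut (fun i j => score_sum w i j (u 0 i - u 0 j)) S|
          <= kappa * Num.sqrt (cut (edge_weight m) S * #|S|%:R)].

(** Union bound over all sets and both signs, given the counts; the failures sum to at most
    [4 * (n * expR (- lam))]. *)
Lemma config_event m : supported m -> good_config pmin pmax m ->
  exists F, [/\ measurable F, F `<=` count_event m `&` regular_sample &
    ((config_weight p m * (1 - 4 * (n%:R * expR (- lam))))%:E <= P F)%E].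
Proof.
move=> supp good.
pose b := T%:R * n%:R * pmin / 8.
have b_gt0 : 0 < b by rewrite divr_gt0// !mulr_gt0// ltr0n.
have cutb (S : {set 'I_n}) : (0 < #|S|)%N -> (2 * #|S| <= n)%N -> b * #|S|%:R <=
  cut (edge_weight m) S.
  move=> S1 S2; move: good => /andP[/forallP/(_ S) + _].
  by rewrite S1 S2.
pose Q (j : {set 'I_n} * bool) := (0 < #|j.1|)%N && (2 * #|j.1| <= n)%N.
(* The boolean is a sign: two one-sided bounds make the absolute value. *)
pose sigma (j : {set 'I_n} * bool) x := (if j.2 then 1 else -1) * boundary_sign j.1 x.
have sigma2 j : \sum_(x <- outcomes m) sigma j x ^+ 2 = cut (edge_weight m) j.1.
  rewrite -boundary_sign_sqr; apply: eq_bigr => x _; rewrite exprMn /sigma.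
  by case: j.2; rewrite ?sqrrN expr1n mul1r.
have sigma_score j w : lscore m (sigma j) w = (if j.2 then 1 else -1)
  * lscore m (boundary_sign j.1) w.
  by rewrite /linear_score mulr_sumr; apply: eq_bigr => x _; rewrite mulrA.
pose a (j : {set 'I_n} * bool) := kappa * Num.sqrt (cut (edge_weight m) j.1 * #|j.1|%:R).
pose eps (j : {set 'I_n} * bool) : R := expR (- lam) ^+ #|j.1|.
have cut_gt0 j : Q j -> (0 : R) < cut (edge_weight m) j.1.
  move=> /andP[j1 j2]; apply: lt_le_trans (cutb _ j1 j2).
  by rewrite mulr_gt0// ltr0n.
have v_gt0 : 0 < 32 * K ^+ 2 by rewrite mulr_gt0// exprn_gt0.
have eps_sum : \sum_(j | Q j) eps j <= 4 * (n%:R * expR (- lam)).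
  have lam2 : n%:R * expR (- lam) <= 1 / 2 by apply: le_trans lam_small _; lra.
  have := sum_nonempty_subsets_expr (expR_ge0 (- lam)) lam2.
  set Z := \sum_(S | _) _ => Z_le.
  suff : \sum_(j | Q j) eps j <= 2 * Z by lra.
  rewrite (eq_bigl (fun j => Q (j.1, true) && xpredT j.2)) => [|[S b']];
    last by rewrite andbT.
  rewrite -(pair_big (fun S => Q (S, true)) xpredT
    (fun S (b' : bool) => expR (- lam) ^+ #|S|))/=.
  rewrite /Z mulr_sumr big_mkcond [leRHS]big_mkcond/=; apply: ler_sum => S _.
  rewrite /Q/= big_bool; case: (0 < #|S|)%N => //=; case: ifP => _; first by lra.
  by rewrite mulr_ge0// exprn_ge0// expR_ge0.
have rect := outcome_rectangles supp.
have mphi (x : idx) : measurable_fun (A : set (measurableTypeR R))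
  (fun y => f y (u 0 x.1.1 - u 0 x.1.2)).
  exact: link_measurable fval _.
have mg (x : idx) : measurable_fun (A : set (measurableTypeR R))
  (fun y => glink f y (u 0 x.1.1 - u 0 x.1.2)).
  exact: (measurable_glink fval fslc).
have phi0 (x : idx) y : A y -> 0 <= f y (u 0 x.1.1 - u 0 x.1.2).
  by move=> Ay; apply/ltW/(link_gt0 fval).
have phi1 (x : idx) := link_integral1 fval (u 0 x.1.1 - u 0 x.1.2).
have mgf (x : idx) l : (\int[mu]_(y in A) (expR (l * glink f y (u 0 x.1.1 - u 0 x.1.2))
  * f y (u 0 x.1.1 - u 0 x.1.2))%:E
    <= (expR (32 * K ^+ 2 * l ^+ 2))%:E)%E.
  apply: le_trans (score_mgf_le l (u_range _ _)) _.
  by rewrite lee_fin ler_expR; apply: le_of_eq; ring.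
have a0 j : Q j -> 0 <= a j by move=> _; rewrite mulr_ge0// sqrtr_ge0.
have V0 j : Q j -> 0 < 32 * K ^+ 2 * \sum_(e <- outcomes m) sigma j e ^+ 2.
  by move=> Qj; rewrite sigma2 mulr_gt0// cut_gt0.
have ae j : Q j -> expR (- (a j ^+ 2 / (4 * (32 * K ^+ 2 * \sum_(e <- outcomes m)
  sigma j e ^+ 2)))) <= eps j.
  move=> Qj; have W0 := cut_gt0 _ Qj; rewrite sigma2 /eps -expRM_natr ler_expR.
  rewrite /a exprMn !sqr_sqrtr; last 2 first.
  - by rewrite mulr_ge0// ltW.
  - by rewrite mulr_ge0// mulr_ge0// ltW.
  apply: le_of_eq; field.
  by rewrite !gt_eqF.
have uo : uniq (outcomes m) by rewrite filter_uniq// enum_uniq.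
have mX (x : idx) : measurable_fun setT (X x.1.1 x.1.2 x.2 : Omega -> R) by exact:
  measurable_funPT.
have [F [mF Fsub PF]] := linear_score_union (measurable_count_event m) uo mX
  (link_domain_measurable fdom) mphi phi0 phi1
    (config_weight_ge0 (fun i j ij => (rates ij).2) m) rect mg mgf a0 V0 ae.
exists F; split=> //; last first.
  apply: le_trans PF; rewrite lee_fin ler_wpM2l//; last by lra.
  exact: (config_weight_ge0 (fun i j ij => (rates ij).2)).
move=> w /Fsub[mw [Aw lt]]; split=> //; exists m.
have Dw := in_domainP mw Aw.
split=> //; first by move=> i j; exact: count_weight.
move=> S S1 S2; have QS b' : Q (S, b') by rewrite /Q S1 S2.
rewrite -(linear_score_cut S mw Dw) ler_norml.
have := lt _ (QS true); have := lt _ (QS false); rewrite !sigma_score /a/=.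
by move=> h1 h2; apply/andP; split; lra.
Qed.

(** The events of the good supported configurations are disjoint, so their probabilities add. The 7
    is 3 for the counts, where [lam] is below the exponent of the cut bound, plus 4 for the
    noise. *)
Lemma regular_sample_probability : pmin <= pmax ->
  (forall i j, i != j -> pmin <= p i j <= pmax) ->
  0 <= pmax -> lam <= T%:R * n%:R * pmin / 8 ->
  exists F, [/\ measurable F, F `<=` regular_sample &
    ((1 - 7 * (n%:R * expR (- lam)))%:E <= P F)%E].
Proof.
move=> pp prange pmax0 lamb.
pose Q m := supported m && good_config pmin pmax m.
have ex m : {F : set Omega | Q m -> [/\ measurable F,
  F `<=` count_event m `&` regular_sample &
    ((config_weight p m * (1 - 4 * (n%:R * expR (- lam))))%:E <= P F)%E]}.
  apply: cid; case: (boolP (Q m)) => [/andP[supp good]|_]; last by exists set0.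
  by have [F hF] := config_event supp good; exists F.
pose F m := sval (ex m).
have FP m : Q m -> [/\ measurable (F m), F m `<=` count_event m `&` regular_sample &
    ((config_weight p m * (1 - 4 * (n%:R * expR (- lam))))%:E <= P (F m))%E].
  exact: (svalP (ex m)).
exists (\bigcup_(m in [set m | Q m]) F m); split.
- by apply: fin_bigcup_measurable => [|m /FP[]//]; exact: finite_finset.
- by move=> w [m /FP[_ sub _] /sub[]].
rewrite measure_fin_bigcup//; last 3 first.
- exact: finite_finset.
- apply/trivIsetP => m1 m2 Q1 Q2 ne; apply/seteqP; split=> // w [w1 w2].
  have [_ /(_ _ w1)[c1 _] _] := FP _ Q1; have [_ /(_ _ w2)[c2 _] _] := FP _ Q2.
  move/eqP : ne; apply; apply/ffunP => e; apply: val_inj.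
  have [ee|ne] := boolP (is_edge e).
    by case: e ee => i j ij; rewrite /= -(c1 _ _ ij) -(c2 _ _ ij).
  have := forallP (andP Q1).1 e; have := forallP (andP Q2).1 e.
  by rewrite (negbTE ne)/= => /eqP -> /eqP ->.
- by move=> m /FP[].
have -> : (\sum_(m \in [set m | Q m]) P (F m) = \sum_(m | Q m) P (F m))%E.
  by rewrite -(@bigfs _ _ _ _ (index_enum _) Q)// ?index_enum_uniq// => m _;
    rewrite mem_index_enum.
have lam2 : n%:R * expR (- lam) <= 1 / 2 by apply: le_trans lam_small _; lra.
have wlow : 1 - 3 * (n%:R * expR (- lam)) <= \sum_(m | Q m) config_weight p m.
  have x_le : expR (- (T%:R * n%:R * pmin / 8)) <= expR (- lam) by rewrite ler_expR lerN2.
  have nx : n%:R * expR (- (T%:R * n%:R * pmin / 8)) <= n%:R * expR (- lam)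
    by rewrite ler_wpM2l.
  have := good_config_weight (fun i j ij => (rates ij).2)
    (fun i j ij => (andP (prange i j ij)).1)
     (fun i j ij => (andP (prange i j ij)).2) pmin_gt0 pmax0 pp (le_trans nx lam2).
  rewrite (bigID supported)/= [X in _ <= _ + X]big1 ?addr0 =>
    [|m /andP[_ /unsupported_weight]//].
  rewrite (eq_bigl Q) => [|m]; last by rewrite /Q andbC.
  lra.
apply: (@le_trans _ _ (\sum_(m | Q m) (config_weight p m *
  (1 - 4 * (n%:R * expR (- lam))))%:E)%E).
  rewrite sumEFin lee_fin -mulr_suml.
  have x0 : 0 <= n%:R * expR (- lam) by rewrite mulr_ge0 ?expR_ge0.
  have := ler_wpM2r (_ : 0 <= 1 - 4 * (n%:R * expR (- lam))) wlow; rewrite subr_ge0.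
  have lam4 := lam_small; move=> /(_ ltac:(lra)); set y := n%:R * _ in x0 *.
  by have := mulr_ge0 x0 x0; lra.
by apply: lee_sum => m /FP[].
Qed.

End Conditioning.

(** * The estimator on a regular sample *)

Section Deterministic.
Context {R : realType} (k : domain_kind) (A : set R) (f : R -> R -> R) (T n : nat).
Context (d : measure_display) (Omega : measurableType d) (P : probability Omega R).
Variables (u : 'rV[R]_n) (p : 'I_n -> 'I_n -> R).
Variables (N : 'I_n -> 'I_n -> {RV P >-> nat}) (X : 'I_n -> 'I_n -> nat -> {RV P >-> R}).
Hypothesis fval : valid_link k A f.
Hypothesis fslc : strictly_log_concave A f.
Hypothesis model : sampling_model k A f T u p N X.
Variables (M K pmin pmax lam c3 : R) (w : Omega) (steps : nat).
Hypothesis u_range : forall i j, `|u 0 i - u 0 j| <= M.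
Hypothesis anchored_u : anchored u.
Hypothesis n_gt0 : (0 < n)%N.
Hypothesis T_gt0 : (0 < T)%N.
Hypothesis pmin_gt0 : 0 < pmin.
Hypothesis pmax_gt0 : 0 < pmax.
Hypothesis c3_gt0 : 0 < c3.
Hypothesis K_gt0 : 0 < K.
Hypothesis lam_gt0 : 0 < lam.
Hypothesis c3_le : forall x y, A x -> `|y| <= M + 1 -> c3 <= `|glink2 f x y|.
Hypothesis regular : regular_sample A f T u N X K pmin pmax lam w.
Hypothesis steps_large : n%:R <= (1 + pmin / (64 * pmax)) ^+ steps.
Let kappa := Num.sqrt (4 * (32 * K ^+ 2) * lam).
Let bound := 4 * steps%:R * (kappa / c3) / Num.sqrt (T%:R * n%:R * pmin / 8).
Hypothesis bound_lt1 : bound < 1.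

(** [bound] is that of [oscillation_bound] with [kappa / c3] as drop constant; the growth rate
    [b / (2 * D)] is [pmin / (64 * pmax)]. Since [bound < 1], the tube constraint is inactive and
    [tube_max_unique] applies. *)
Lemma regular_sample_mle : exists v, unique (is_mle f N X w) v /\ `|v - u| <= bound.
Proof.
have [m [/andP[/forallP good1 /forallP good2] Nw Aw noise]] := regular.
pose L (i j : 'I_n) y := \sum_(t < N i j w) ln (f (X i j t w) y).
pose G := score_sum f N X w.
pose wt : 'I_n -> 'I_n -> R := edge_weight m.
have wt0 i j : 0 <= wt i j by exact: edge_weight_ge0.
have wtC i j : wt i j = wt j i by exact: edge_weight_sym.
have lt_tan i j t y z : i != j -> (t < N i j w)%N -> y != z ->
    ln (f (X i j t w) z) < ln (f (X i j t w) y) + glink f (X i j t w) y * (z - y).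
  by move=> ij tN; apply: (ln_link_tangent fslc); exact: Aw.
have le_tan i j t y z : i != j -> (t < N i j w)%N ->
    ln (f (X i j t w) z) <= ln (f (X i j t w) y) + glink f (X i j t w) y * (z - y).
  move=> ij tN; case: (eqVneq y z) => [->|yz]; first by rewrite subrr mulr0 addr0.
  exact/ltW/lt_tan.
have L_tangent i j y z : i != j -> L i j z <= L i j y + G i j y * (z - y).
  move=> ij; rewrite /L /G /score_sum mulr_suml -big_split; apply: ler_sum => t _.
  exact: le_tan.
have L_tangent_lt i j y z : i != j -> 0 < wt i j -> y != z ->
    L i j z < L i j y + G i j y * (z - y).
  move=> ij; rewrite /wt -Nw// ltr0n => N0 yz.
  rewrite /L /G /score_sum mulr_suml -big_split.
  rewrite (bigD1 (Ordinal N0))//= [ltRHS](bigD1 (Ordinal N0))//=; apply: ltr_leD;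
    first exact: lt_tan.
  by apply: ler_sum => t _; exact: le_tan.
have L_cont i j : i != j -> continuous (L i j).
  move=> ij; apply: (@continuous_big R _ +%R 0 _ (@add_continuous R)) => t _ y.
  apply: differentiable_continuous; apply/derivable1_diffP.
  by have [] := fslc y (Aw i j t ij (ltn_ord t)).
have G_anti i j y : i != j -> G j i (- y) = - G i j y.
  by move=> ij; exact: (score_sum_anti fval fslc model).
have G_slope i j y z : i != j -> `|y| <= M + 1 -> `|z| <= M + 1 ->
    y <= z -> c3 * wt i j * (z - y) <= G i j y - G i j z.
  move=> ij yM zM yz; rewrite /wt -Nw// /G /score_sum -sumrB.
  rewrite mulrAC mulr_natr -{1}(card_ord (N i j w)) -sumr_const; apply: ler_sum => t _.
  by apply: (glink_slope fslc (Aw i j t ij (ltn_ord t)) yM zM yz) => s; exact: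
    (c3_le (Aw i j t ij (ltn_ord t))).
pose o := Ordinal n_gt0.
have o0 : o = 0%N :> nat by [].
have [v vt vmax] := @anchored_tube_max _ _ L u o o0 anchored_u L_cont.
have drop := tube_max_drop o0 L_tangent G_anti vt vmax wt0 u_range (ltW c3_gt0) G_slope.
pose dl i := v 0 i - u 0 i.
pose b := T%:R * n%:R * pmin / 8.
have Tn0 : 0 < T%:R * n%:R :> R by rewrite mulr_gt0// ltr0n.
have b0 : 0 < b by rewrite divr_gt0// mulr_gt0.
have D0 : 0 < 4 * (T%:R * n%:R * pmax) by rewrite !mulr_gt0// ltr0n.
have kappa0 : 0 < kappa by rewrite sqrtr_gt0 !mulr_gt0// exprn_gt0.
have osc i j : dl i - dl j <= bound.
  rewrite /bound; apply: (oscillation_bound (w := wt) (D := 4 * (T%:R * n%:R * pmax)))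
    => //.
  - by rewrite divr_gt0.
  - by move=> S S1 S2; have := good1 S; rewrite S1 S2.
  - move=> c S S1 S2.
    have := drop S; rewrite -/dl => /(_ _) h.
    have {h} : c3 * cut (fun i j => wt i j * (dl i - dl j)) S <=
      cut (fun i j => G i j (u 0 i - u 0 j)) S.
      apply: h => a e; rewrite finset.in_setC !in_upset -ltNge => ac ec.
      exact: lt_le_trans ec ac.
    move=> h; rewrite mulrAC ler_pdivlMr// mulrC; apply: le_trans h _.
    by apply: le_trans (ler_norm _) _; exact: noise.
  - move=> c S S1 S2.
    (* Here [S] is a lower set of [dl], so the drop inequality is used on its complement; in the
       passage back to [S] the score changes sign, which the absolute value in the noise bound
       absorbs. *)
    have h : c3 * cut (fun i j => wt i j * (dl i - dl j)) (~: S) <=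
      cut (fun i j => G i j (u 0 i - u 0 j)) (~: S).
      apply: drop => a e; rewrite finset.setCK finset.in_setC !in_upset -ltNge => ac ec.
      by rewrite -ltrN2; exact: lt_le_trans ac ec.
    have E1 : cut (fun i j => wt i j * (dl i - dl j)) (~: S) =
      cut (fun i j => wt i j * (dl j - dl i)) S.
      rewrite /cut exchange_big finset.setCK/=; apply: eq_bigr => a _; apply: eq_bigr =>
        e _.
      by rewrite wtC.
    have E2 : cut (fun i j => G i j (u 0 i - u 0 j)) (~: S) =
      - cut (fun i j => G i j (u 0 i - u 0 j)) S.
      rewrite /cut exchange_big finset.setCK/= -sumrN; apply: eq_bigr => a aS;
        rewrite -sumrN.
      apply: eq_bigr => e eS; rewrite -G_anti ?opprB//.
      by apply: contraTneq eS => <-; rewrite finset.in_setC aS.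
    rewrite E1 E2 in h; rewrite mulrAC ler_pdivlMr// mulrC; apply: le_trans h _.
    by apply: le_trans (ler_norm _) _; rewrite normrN; exact: noise.
  - suff -> : T%:R * n%:R * pmin / 8 / (2 * (4 * (T%:R * n%:R * pmax))) =
    pmin / (64 * pmax) by [].
    by field; rewrite !gt_eqF// ltr0n.
have conn (S : {set 'I_n}) : (0 < #|S|)%N -> (2 * #|S| <= n)%N -> 0 < cut wt S.
  move=> S1 S2; have := good1 S; rewrite S1 S2/=; apply: lt_le_trans.
  by rewrite mulr_gt0// ltr0n.
have dl1 i j : dl i - dl j < 1 by exact: le_lt_trans bound_lt1.
have uniq_max v' : anchored v' -> v' != v -> pairwise_objective L v' <
  pairwise_objective L v.
  exact: (tube_max_unique o0 L_tangent L_tangent_lt vt vmax wt0 wtC conn dl1).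
have llE v' : log_likelihood f N X w v' = 2^-1 * pairwise_objective L v' by [].
exists v; split.
  split.
    split=> [|v' av']; first exact: vt.1.
    rewrite !llE ler_pM2l ?invr_gt0//; case: (eqVneq v' v) => [->//|ne].
    exact/ltW/uniq_max.
  move=> v' [av' max']; apply/eqP; apply: contraT => ne.
  have := max' v vt.1; rewrite !llE ler_pM2l ?invr_gt0// leNgt uniq_max//.
  by rewrite eq_sym.
have bound0 : 0 <= bound by have := osc o o; rewrite subrr.
rewrite [leLHS]/Num.Def.normr/= mx_normrE; apply: bigmax_le => // -[i j] _ /=.
rewrite (ord1 i) !mxE.
(* The error at the anchor is 0, so each error is itself an oscillation. *)
have -> : v 0 j - u 0 j = dl j - dl o by rewrite /dl (vt.1 _ o0) (anchored_u o0); ring.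
by rewrite ler_norml osc andbT -lerN2 opprK opprB osc.
Qed.

End Deterministic.

(** * Rates *)

Section Asymptotics.
Context {R : realType}.

(** Whichever ratio attains the minimum, a finite [omega] has a real numerator [K] and a positive
    real denominator [c3], so extended reals are left behind. *)
Lemma omega_finite (A : set R) (f : R -> R -> R) (M C4 : R) :
  0 <= M -> A !=set0 -> (omega A f M C4 < +oo)%E ->
  exists K c3, [/\ 0 < c3,
    K = C4 \/ (forall x y, A x -> `|y| <= M -> `|glink f x y| <= K),
    omega A f M C4 = (K / c3)%:E &
    forall x y, A x -> `|y| <= M + 1 -> c3 <= `|glink2 f x y|].
Proof.
move=> M0 [x0 Ax0] omega_fin.
have M1 : 0 <= M + 1 by lra.
have c3_le x y : A x -> `|y| <= M + 1 -> (C3 A f M <= (`|glink2 f x y|)%:E)%E.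
  by move=> Ax yM; apply: ereal_inf_lbound; exists (x, y).
have le_c2 x y : A x -> `|y| <= M -> ((`|glink f x y|)%:E <= C2 A f M)%E.
  by move=> Ax yM; apply: ereal_sup_ubound; exists (x, y).
have c3_ge0 : (0 <= C3 A f M)%E.
  by apply: le_ereal_inf_tmp => _ [[x y] _ <-]; rewrite lee_fin.
have c3_lty : (C3 A f M < +oo)%E.
  by apply: le_lt_trans (c3_le x0 0 Ax0 _) _; rewrite ?normr0// ltry.
have c2_ge0 : (0 <= C2 A f M)%E.
  by apply: le_trans (le_c2 x0 0 Ax0 _); rewrite ?normr0// lee_fin.
case E3 : (C3 A f M) c3_ge0 c3_lty c3_le => [c3||]// c3_ge0 _ c3_le.
have [c30|c3_neq0] := eqVneq c3 0.
  (* By the convention on [ratio], a zero denominator makes both ratios infinite. *)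
  by move: omega_fin; rewrite /omega /ratio E3 c30 eqxx !orbT minxx ltxx.
have c3_gt0 : 0 < c3 by rewrite lt_neqAle eq_sym c3_neq0 -lee_fin.
have ratioE (a : R) : ratio a%:E c3%:E = (a / c3)%:E.
  by rewrite /ratio eqe (negbTE c3_neq0)/= inver (negbTE c3_neq0).
have c3_le' x y : A x -> `|y| <= M + 1 -> c3 <= `|glink2 f x y|.
  by move=> Ax yM; rewrite -lee_fin; exact: c3_le.
move: omega_fin; rewrite /omega E3 ratioE.
case E2 : (C2 A f M) c2_ge0 le_c2 => [c2||]// _ le_c2.
  rewrite ratioE => _; rewrite /Order.min; case: ifP => _.
    by exists C4, c3; split=> //; left.
  exists c2, c3; split=> //; right=> x y Ax yM; rewrite -lee_fin; exact: le_c2.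
(* [C2] is infinite here, so the minimum is the ratio of [C4]. *)
rewrite {2}/ratio eqxx/= => _; rewrite /Order.min ltry.
by exists C4, c3; split=> //; left.
Qed.

Lemma ln_ge1 (n : nat) : (4 <= n)%N -> 1 <= ln n%:R :> R.
Proof.
move=> n4; rewrite -[leLHS]expRK ler_ln ?posrE ?expR_gt0 ?ltr0n//; last by lia.
apply: (@le_trans _ _ 4); last by rewrite (ler_nat R 4 n).
have -> : (1 : R) = 1 / 2 + 1 / 2 by lra.
rewrite expRD.
have e12 := @expR_half_le2 R.
have := ler_pM (expR_ge0 _) (expR_ge0 _) e12 e12; lra.
Qed.

(** As [r <= 1], [1 + r >= expR (r / 2)], and [y = 128 * (q / p) * ln n] satisfies
    [r / 2 * y = ln n]. Rounding up at most doubles [y], whence 256. *)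
Lemma growth_steps (n : nat) (p q : R) : (4 <= n)%N -> 0 < p -> p <= q ->
  exists2 s : nat, n%:R <= (1 + p / (64 * q)) ^+ s & s%:R <= 256 * (q / p) * ln n%:R.
Proof.
move=> n4 p0 pq; have q0 : 0 < q by exact: lt_le_trans pq.
have n0 : 0 < n%:R :> R by rewrite ltr0n; lia.
have ln1 := ln_ge1 n4.
set r := p / (64 * q).
have r0 : 0 < r by rewrite divr_gt0// mulr_gt0.
have r1 : r <= 1 by rewrite ler_pdivrMr ?mulr_gt0// mul1r; lra.
have qp1 : 1 <= q / p by rewrite ler_pdivlMr// mul1r.
pose y := 128 * (q / p) * ln n%:R.
have y1 : 1 <= y.
  have : 1 * 1 <= q / p * ln n%:R by apply: ler_pM.
  by rewrite /y; lra.
have y0 : 0 <= y by lra.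
exists (Num.trunc y).+1; last first.
  have := truncn_le y; rewrite y0 => h.
  by rewrite -natr1; apply: (@le_trans _ _ (y + y)); [lra|rewrite /y; lra].
have e1 : expR (r / 2) <= 1 + r.
  rewrite -[leLHS]invrK -expRN invf_ple ?posrE ?expR_gt0//; last lra.
  apply: le_trans (expR_ge1Dx _); rewrite -[leLHS]mul1r ler_pdivrMr; last lra.
  by have := mulr_ge0 (ltW r0) (_ : 0 <= 1 - r); rewrite subr_ge0 => /(_ r1); lra.
apply: (@le_trans _ _ (expR (r / 2) ^+ (Num.trunc y).+1)); last first.
  by apply: lerXn2r; rewrite ?nnegrE ?expR_ge0//; lra.
rewrite -expRM_natr -[leLHS](lnK (x := n%:R)) ?posrE// ler_expR.
apply: (@le_trans _ _ (r / 2 * y)).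
  apply: le_of_eq; rewrite /r /y; field.
  by rewrite !gt_eqF.
by apply: ler_wpM2l; [lra|exact/ltW/truncnS_gt].
Qed.

(* [1024 = 4 * 256] and [79 ^+ 2 >= 6144 = 8 * 768]; see [error_bound]. *)
Definition rate_const : R := 1024 * 79.

(** One descent costs order [K / c3 * sqrt (ln n / (n * p))], and there are order [(q / p) * ln n]
    of them. [T] enters only through [T >= 1], so the constant is absolute. *)
Lemma error_bound (n T s : nat) (p q K c3 : R) : (4 <= n)%N -> (0 < T)%N ->
  0 < p -> p <= q -> 0 < K -> 0 < c3 -> s%:R <= 256 * (q / p) * ln n%:R ->
  4 * s%:R * (Num.sqrt (4 * (32 * K ^+ 2) * (6 * ln n%:R)) / c3)
    / Num.sqrt (T%:R * n%:R * p / 8)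
  <= rate_const * (K / c3 * Num.sqrt (q ^+ 2 * ln n%:R ^+ 3 / (n%:R * p ^+ 3))).
Proof.
move=> n4 T0 p0 pq K0 c0 sle; have q0 : 0 < q by exact: lt_le_trans pq.
have n0 : 0 < n%:R :> R by rewrite ltr0n; lia.
have ln0 : 0 < ln n%:R :> R by apply: lt_le_trans (ln_ge1 n4).
set l := ln n%:R in sle ln0 *.
have T1 : 1 <= T%:R :> R by rewrite ler1n.
have np0 : 0 < n%:R * p by rewrite mulr_gt0.
have -> : Num.sqrt (4 * (32 * K ^+ 2) * (6 * l)) = K * Num.sqrt (768 * l).
  rewrite (_ : 4 * (32 * K ^+ 2) * (6 * l) = K ^+ 2 * (768 * l)); last by ring.
  by rewrite sqrtrM ?sqr_ge0// sqrtr_sqr gtr0_norm.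
have -> : Num.sqrt (q ^+ 2 * l ^+ 3 / (n%:R * p ^+ 3)) =
  q / p * l * Num.sqrt (l / (n%:R * p)).
  rewrite (_ : q ^+ 2 * l ^+ 3 / (n%:R * p ^+ 3) = (q / p * l) ^+ 2 * (l / (n%:R * p)));
    last first.
    by field; rewrite !gt_eqF.
  by rewrite sqrtrM ?sqr_ge0// sqrtr_sqr gtr0_norm// mulr_gt0// divr_gt0.
have [c [c_ge0 c2 cE]] : exists c : R, [/\ 0 <= c, 6144 <= c ^+ 2 & rate_const =
  1024 * c].
  by exists 79; split=> //; rewrite expr2; lra.
have h1 : Num.sqrt (768 * l) / Num.sqrt (T%:R * n%:R * p / 8) <=
  c * Num.sqrt (l / (n%:R * p)).
  have X0 : 0 < T%:R * n%:R * p / 8 by rewrite divr_gt0// -mulrA mulr_gt0// ltr0n.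
  rewrite -sqrtrV ?(ltW X0)// -sqrtrM; last exact: mulr_ge0 (ler0n _ _) (ltW ln0).
  rewrite -[c](ger0_norm c_ge0) -sqrtr_sqr -sqrtrM ?sqr_ge0//; apply: ler_wsqrtr.
  have -> : 768 * l * (T%:R * n%:R * p / 8)^-1 = 6144 / T%:R * (l / (n%:R * p)).
    by field; rewrite !gt_eqF// (lt_le_trans ltr01 T1).
  apply: ler_wpM2r; first by rewrite divr_ge0// ltW.
  apply: le_trans c2; rewrite ler_pdivrMr; last lra.
  lra.
set r := Num.sqrt (l / (n%:R * p)) in h1 *.
have r0 : 0 <= r by exact: sqrtr_ge0.
set a := Num.sqrt _ in h1 *; set b := Num.sqrt _ in h1 *.
have -> : 4 * s%:R * (K * a / c3) / b = (4 * (K / c3)) * (s%:R * (a / b))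
  by rewrite !mulrA; ring.
have h2 : s%:R * (a / b) <= (256 * (q / p) * l) * (c * r).
  by apply: ler_pM => //; rewrite divr_ge0 ?sqrtr_ge0.
apply: le_trans (ler_wpM2l _ h2) _; first by rewrite mulr_ge0// divr_ge0// ?(ltW K0)
  ?(ltW c0).
by rewrite cE; apply: le_of_eq; ring.
Qed.

(** Since [q / p] and [ln n] are at least 1, the quantity under the root dominates [ln n / (n * p)],
    which is thus below 1/49. The 48 is 6, from [lam = 6 * ln n], times the 8 in the cut
    threshold. *)
Lemma connectivity_threshold (n : nat) (p q : R) : (4 <= n)%N -> 0 < p -> p <= q ->
  Num.sqrt (q ^+ 2 * ln n%:R ^+ 3 / (n%:R * p ^+ 3)) < 1 / 7 ->
  48 * ln n%:R <= n%:R * p.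
Proof.
move=> n4 p0 pq; have q0 : 0 < q by exact: lt_le_trans pq.
have n0 : 0 < n%:R :> R by rewrite ltr0n; lia.
have ln1 := ln_ge1 n4.
have np0 : 0 < n%:R * p by rewrite mulr_gt0.
set l := ln n%:R in ln1 *; have l0 : 0 < l by lra.
have -> : q ^+ 2 * l ^+ 3 / (n%:R * p ^+ 3) = l / (n%:R * p) * ((q / p) * l) ^+ 2.
  by field; rewrite !gt_eqF.
set a := l / (n%:R * p) * _ => lt7.
have a0 : 0 <= a.
  by apply: mulr_ge0; [exact/ltW/divr_gt0|exact: sqr_ge0].
have a49 : a <= 1 / 49.
  rewrite -(sqr_sqrtr a0) expr2.
  by have := ler_pM (sqrtr_ge0 a) (sqrtr_ge0 a) (ltW lt7) (ltW lt7); lra.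
have h : l / (n%:R * p) <= a.
  apply: ler_peMr; first exact/ltW/divr_gt0.
  apply: exprn_ege1; rewrite -[leLHS]mulr1; apply: ler_pM => //.
  by rewrite ler_pdivlMr// mul1r.
have := le_trans h a49; rewrite ler_pdivrMr//; lra.
Qed.

Lemma mul_lt1 (c x : R) : 0 < c -> 0 <= x -> x < 1 / (2 * c) -> c * x < 1.
Proof.
move=> c0 x0; rewrite ltr_pdivlMr ?mulr_gt0// => h.
by have := mulr_ge0 x0 (ltW c0); lra.
Qed.

(** The gain of 64 absorbs the factor 7 of [regular_sample_probability]. *)
Lemma inv_pow5_le (n : nat) : (4 <= n)%N -> n%:R ^- 5 <= n%:R ^- 2 / 64 :> R.
Proof.
move=> n4; have n4R : 4 <= n%:R :> R by rewrite (ler_nat R 4 n).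
have -> : (n%:R ^- 5 : R) = n%:R ^- 2 * n%:R ^- 3 by field; lra.
apply: ler_wpM2l; first by rewrite invr_ge0 exprn_ge0.
rewrite lef_pV2 ?posrE ?exprn_gt0 ?ltr0n//; last by lia.
rewrite (_ : 64 = 4 ^+ 3); last by ring.
by rewrite ler_pXn2r ?nnegrE.
Qed.

End Asymptotics.

Section Rates.
Context {R : realType} (n : nat).
Implicit Types (p : 'I_n -> 'I_n -> R) (u : 'rV[R]_n).

Lemma dynamic_range_ge u i j : `|u 0 i - u 0 j| <= dynamic_range u.
Proof. exact: (le_bigmax _ (fun ij : 'I_n * 'I_n => `|u 0 ij.1 - u 0 ij.2|) (i, j)). Qed.

Lemma dynamic_range_ge0 u : 0 <= dynamic_range u.
Proof. exact: bigmax_ge_id. Qed.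

Lemma rate_range p i j : i != j -> min_rate p <= p i j <= max_rate p.
Proof.
move=> ij; apply/andP; split.
  exact: (@bigmin_le_cond _ _ _ _ (i, j) (fun ij => ij.1 != ij.2)
    (fun ij : 'I_n * 'I_n => p ij.1 ij.2)).
exact: (@le_bigmax_cond _ _ _ _ (i, j) (fun ij => ij.1 != ij.2)
  (fun ij : 'I_n * 'I_n => p ij.1 ij.2)).
Qed.

Lemma min_rate_gt0 p : comparison_rates p -> 0 < min_rate p.
Proof. by move=> rates; apply: lt_bigmin => // -[i j] /= /rates[_ /andP[]]. Qed.

Lemma expRN_6ln : (0 < n)%N -> n%:R * expR (- (6 * ln n%:R)) = n%:R ^- 5 :> R.
Proof.
move=> n0; have n0' : 0 < n%:R :> R by rewrite ltr0n.
rewrite expRN expRM_natl lnK ?posrE//; field; lra.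
Qed.
End Rates.

Theorem theorem3 (R : realType) :
  exists C : R, 0 < C /\
  forall (k : domain_kind) (A : set R) (f : R -> R -> R) (T : nat)
    (d : nat -> measure_display)
    (Omega : forall n, measurableType (d n))
    (P : forall n, probability (Omega n) R)
    (u : forall n, 'rV[R]_n)
    (p : forall n, 'I_n -> 'I_n -> R)
    (N : forall n, 'I_n -> 'I_n -> {RV (P n) >-> nat})
    (X : forall n, 'I_n -> 'I_n -> nat -> {RV (P n) >-> R})
    (C4 : nat -> R),
  link_domain k A ->
  valid_link k A f ->
  strictly_log_concave A f ->
  (1 <= T)%N ->
  (forall n, anchored (u n)) ->
  (forall n, comparison_rates (p n)) ->
  (forall n, sampling_model k A f T (u n) (p n) (N n) (X n)) ->
  (forall n, (score_psi2_sup k A f (dynamic_range (u n)) <= (C4 n)%:E)%E) ->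
  Delta A f (u n) (p n) (C4 n) @[n --> \oo] --> 0%E ->
  ln n%:R / (n%:R * min_rate (p n) * `|ln (C1 k A f (dynamic_range (u n)))|)
    @[n --> \oo] --> (0 : R) ->
  \forall n \near \oo,
    with_probability_at_least (P n) (1 - n%:R ^- 2)
      [set w | exists uhat : 'rV[R]_n,
         unique (is_mle f (N n) (X n) w) uhat /\
         ((`|uhat - u n|)%:E <= C%:E * Delta A f (u n) (p n) (C4 n))%E].
Proof.
have C0 : 0 < rate_const :> R by rewrite /rate_const; lra.
exists rate_const; split=> // k A f T d Omega P u p N X C4 fdom fval fslc T1 anch rates
  model psi2 cvgD _.
have [x0 Ax0] : A !=set0.
  apply/set0P/negP => /eqP A0; have := link_integral1 fval 0;
    rewrite A0 integral_set0 => -[] /eqP.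
  by rewrite eq_sym oner_eq0.
have [t0 t0_gt0 subg] := score_subgaussian fdom fval fslc.
pose c0 := `|glink2 f x0 0|.
have c0_gt0 : 0 < c0 by rewrite normr_gt0 lt_eqF//; have [] := fslc x0 0 Ax0.
(* A lower bound for [omega] independent of [n]: [K >= t0 / 2], and [c3 <= c0] because the point
   [(x0, 0)] enters every infimum [C3]. *)
pose omega0 := t0 / (2 * c0).
have omega0_gt0 : 0 < omega0 by rewrite divr_gt0// mulr_gt0.
(* The first threshold makes the error bound less than 1; the second, through [omega0], forces the
   square root in [Delta] below 1/7. *)
pose e := Num.min (1 / (2 * rate_const)) (omega0 / 7).
have e_gt0 : 0 < e by rewrite lt_min !divr_gt0// mulr_gt0.
have /fine_cvgP[finD cvD] := cvgD.
have smallD : \forall n \near \oo, `|fine (Delta A f (u n) (p n) (C4 n))| < e.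
  exact: (cvgr0_norm_lt _ cvD).
near=> n.
have finn : Delta A f (u n) (p n) (C4 n) \is a fin_num by near: n.
have smalln : `|fine (Delta A f (u n) (p n) (C4 n))| < e by near: n.
have n4 : (4 <= n)%N by near: n; exact: nbhs_infty_ge.
set M := dynamic_range (u n); set Dn := Delta _ _ _ _ _ in finn smalln *.
set q := max_rate (p n); set pm := min_rate (p n).
have n_gt0 : (0 < n)%N by lia.
have n4R : 4 <= n%:R :> R by rewrite (ler_nat R 4 n).
have pm_gt0 : 0 < pm by exact: min_rate_gt0.
have pmq : pm <= q.
  (* With an actual pair of distinct indices, the default values of [min_rate] and [max_rate] do not
     disturb their comparison. *)
  have n1 : (1 < n)%N by lia.
  have ij : Ordinal n_gt0 != Ordinal n1 by [].
  by have /andP[] := rate_range (p n) ij; exact: le_trans.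
have q_gt0 : 0 < q by exact: lt_le_trans pmq.
have M_ge0 : 0 <= M by exact: dynamic_range_ge0.
have ln1 := @ln_ge1 R n n4.
have ln_gt0 : 0 < ln n%:R :> R by lra.
pose S := Num.sqrt (q ^+ 2 * ln n%:R ^+ 3 / (n%:R * pm ^+ 3)).
have S2_gt0 : 0 < q ^+ 2 * ln n%:R ^+ 3 / (n%:R * pm ^+ 3).
  by rewrite divr_gt0// mulr_gt0// ?exprn_gt0//; lra.
have S_gt0 : 0 < S by rewrite sqrtr_gt0.
have DE : Dn = (omega A f M (C4 n) * S%:E)%E by [].
have omega_fin : (omega A f M (C4 n) < +oo)%E.
  rewrite ltey; apply/eqP => oy; move: finn; rewrite DE oy.
  by rewrite gt0_mulye ?lte_fin.
have [K [c3 [c3_gt0 Kcase omegaE c3_le]]] := omega_finite M_ge0 (ex_intro _ x0 Ax0)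
  omega_fin.
have [tK mgf] := subg M (C4 n) K M_ge0 (psi2 n) Kcase.
have K_gt0 : 0 < K by lra.
have {}DE : Dn = (K / c3 * S)%:E by rewrite DE omegaE.
have Kc3_gt0 : 0 < K / c3 by rewrite divr_gt0.
have small : K / c3 * S < e.
  by move: smalln; rewrite /= DE/= ger0_norm// ltW// mulr_gt0.
have c3c0 : c3 <= c0 by apply: c3_le => //; rewrite normr0; lra.
have omega_ge : omega0 <= K / c3.
  rewrite /omega0 ler_pdivrMr ?mulr_gt0// mulrAC ler_pdivlMr//.
  apply: (@le_trans _ _ (t0 * c0)); first by rewrite ler_wpM2l// ltW.
  by have := ler_wpM2r (ltW c0_gt0) tK; lra.
have S_small : S < 1 / 7.
  have : omega0 * S < omega0 / 7.
    apply: le_lt_trans (_ : _ <= K / c3 * S) _; first by rewrite ler_wpM2r// ltW.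
    by apply: lt_le_trans small _; rewrite ge_min lexx orbT.
  by rewrite ltr_pM2l// div1r.
have np_large : 48 * ln n%:R <= n%:R * pm by exact: connectivity_threshold pmq S_small.
(* Then [n * expR (- lam)] is [n ^- 5], and seven times this is at most [n ^- 2]. *)
pose lam : R := 6 * ln n%:R.
have lam_gt0 : 0 < lam by rewrite /lam; lra.
have nlam : n%:R * expR (- lam) = n%:R ^- 5 by exact: expRN_6ln.
have n5 := @inv_pow5_le R n n4.
have n2 : (n%:R ^- 2 : R) <= 1.
  by rewrite invf_le1 ?exprn_gt0 ?ltr0n// exprn_ege1//; lra.
have lamT : lam <= T%:R * n%:R * pm / 8.
  have T1R : 1 <= T%:R :> R by rewrite ler1n.
  have := ler_wpM2r (_ : 0 <= n%:R * pm) T1R; rewrite mulr_ge0 ?(ltW pm_gt0)// =>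
    /(_ isT).
  by rewrite /lam; lra.
have lam_small : n%:R * expR (- lam) <= 1 / 4 by rewrite nlam; lra.
have mgf' y l : `|y| <= M -> _ := fun yM => mgf y l yM.
have [F [mF Fsub PF]] := regular_sample_probability fdom fval fslc (rates n) (model n)
  (dynamic_range_ge (u n)) K_gt0 mgf' pm_gt0 n_gt0 T1 (ltW lam_gt0) lam_small pmq
  (fun i j ij => rate_range (p n) ij) (ltW q_gt0) lamT.
exists F; split=> //; last first.
  apply: le_trans PF; rewrite lee_fin nlam.
  have : 0 <= (n%:R ^- 2 : R) by rewrite invr_ge0 exprn_ge0.
  lra.
move=> w /Fsub reg /=.
have [s s1 s2] := growth_steps n4 pm_gt0 pmq.
have bnd := error_bound n4 T1 pm_gt0 pmq K_gt0 c3_gt0 s2.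
have bnd1 : rate_const * (K / c3 * S) < 1.
  apply: mul_lt1 => //; first exact/ltW/mulr_gt0.
  by apply: lt_le_trans small _; rewrite ge_min lexx.
have [v [vu vb]] := regular_sample_mle fval fslc (model n) (dynamic_range_ge (u n))
  (anch n)
  n_gt0 T1 pm_gt0 q_gt0 c3_gt0 K_gt0 lam_gt0 c3_le reg s1 (le_lt_trans bnd bnd1).
exists v; split=> //.
by rewrite DE -EFinM lee_fin; apply: le_trans vb bnd.
Unshelve. all: by end_near.
Qed.
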